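(* Let $n>2$, let $1<p<\frac{n^2+n}{n^2+n-4}$, and let $X_1=\frac{\partial}{\partial x_1}$ and $X_2=x_1\frac{\partial}{\partial x_2}+x_2\frac{\partial}{\partial x_3}+\dots+x_{n-1}\frac{\partial}{\partial x_n}$ on $\mathbb{R}^n$, with $X=(X_1,X_2)$. Let $u_0\in L^1_{\mathrm{loc}}(\mathbb{R}^n)$. If $f\in L^1_{\mathrm{loc}}(\mathbb{R}^n)$ with $\int_{\mathbb{R}^n}f(x)\,dx>0$, then the problem $u_t-\Delta_X u=|u|^p+f(x)$ in $(0,\infty)\times\mathbb{R}^n$, $u(0,x)=u_0(x)$, does not admit a global in time weak solution.
   Context: For a system $X=(X_1,\dots,X_m)$ of real $C^\infty$ vector fields, $\Delta_X=-\sum_{k=1}^m X_k^\ast X_k$ with $X_k^\ast=-X_k-\operatorname{div}X_k$; here the vector fields are divergence free, so $\Delta_X=X_1^2+X_2^2$. Weak solution: for $f,u_0\in L^1_{\mathrm{loc}}(\mathbb{R}^n)$, a function $u\in L^p_{\mathrm{loc}}((0,T),L^p_{\mathrm{loc}}(\mathbb{R}^n))$ is a local in time weak solution (on $[0,T)$) of $u_t-\Delta_X u=|u|^p+f(x)$, $u(0,x)=u_0(x)$, if for every non-negative test function $\psi\in C^1_c([0,T);C^2_c(\mathbb{R}^n))$ one has $\int_0^T\!\int_{\mathbb{R}^n}|u|^p\psi+\int_{\mathbb{R}^n}u_0\psi(0,x)+\int_0^T\!\int_{\mathbb{R}^n}f\psi+\int_0^T\!\int_{\mathbb{R}^n}u\psi_t+\int_0^T\!\int_{\mathbb{R}^n}u\,\Delta_X\psi=0$.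 When $T=\infty$, such $u$ is called a global in time weak solution. *)

(* Defs.v *)
From HB Require Import structures.
From mathcomp Require Import all_boot all_order all_algebra.
From mathcomp Require Import all_classical all_reals all_analysis.
From mathcomp Require Import measurable_realfun.

Set Implicit Arguments.
Unset Strict Implicit.
Unset Printing Implicit Defensive.
Import Order.TTheory GRing.Theory Num.Theory.
Import numFieldNormedType.Exports.

Local Open Scope classical_set_scope.
Local Open Scope ring_scope.

Definition measure_rV_display : measure_display -> measure_display.
Proof. exact. Qed.

Section measurable_rV.
Context {d} {T : measurableType d}.
Variable n : nat.

Let coors : 'I_n -> 'rV[T]_n -> T := fun i x => x ord0 i.

Let rV_set0 : g_sigma_preimage coors set0.
Proof. exact: sigma_algebra0. Qed.

Let rV_setC A : g_sigma_preimage coors A -> g_sigma_preimage coors (~` A).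
Proof. exact: sigma_algebraC. Qed.

Let rV_bigcup (F : _^nat) : (forall i, g_sigma_preimage coors (F i)) ->
  g_sigma_preimage coors (\bigcup_i (F i)).
Proof. exact: sigma_algebra_bigcup. Qed.

HB.instance Definition _ := @isMeasurable.Build (measure_rV_display d)
  'rV[T]_n (g_sigma_preimage coors) rV_set0 rV_setC rV_bigcup.

End measurable_rV.

Lemma measurable_rV_coord d (T : measurableType d) n (i : 'I_n) :
  measurable_fun [set: 'rV[T]_n] (fun x : 'rV[T]_n => x ord0 i).
Proof.
move=> _ Y mY; rewrite setTI; apply: sub_sigma_algebra => /=.
rewrite -bigcup_seq/=; exists i => /=; first by rewrite mem_index_enum.
by exists Y => //; rewrite setTI.
Qed.

Lemma measurable_fun_rVP d1 d2 (T1 : measurableType d1) (T2 : measurableType d2)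
    n (f : T1 -> 'rV[T2]_n) :
  measurable_fun [set: T1] f <->
  forall i, measurable_fun [set: T1] (fun x => f x ord0 i).
Proof.
split=> [mf i|mf].
  exact: (measurableT_comp (@measurable_rV_coord _ _ _ i)).
have H : g_sigma_preimage (fun i x => f x ord0 i) `<=` measurable.
  apply: smallest_sub; first exact: sigma_algebra_measurable.
  rewrite -bigcup_seq => A [i /= _ [B mB <-]].
  exact: mf.
rewrite (g_sigma_preimage_comp (fun i (x : 'rV[T2]_n) => x ord0 i) f) in H.
by move=> _ A mA; apply: H; exists A.
Qed.

(* The sigma-algebra generated by the coordinates contains the open sets of
   'rV[R]_n, hence it is the Borel sigma-algebra. *)
Lemma open_measurable_rV (R : realType) n (U : set 'rV[R]_n) :
  open U -> measurable U.
Proof.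
move=> oU.
pose c (qk : 'rV[rat]_n * nat) : 'rV[R]_n := map_mx ratr qk.1.
pose B (qk : 'rV[rat]_n * nat) : set 'rV[R]_n :=
  [set y | forall i, ball (c qk ord0 i) (qk.2.+1%:R^-1) (y ord0 i)].
have mB qk : measurable (B qk).
  rewrite (_ : B qk = \bigcap_(i in [set: 'I_n]) ((fun x : 'rV[R]_n => x ord0 i)
      @^-1` ball (c qk ord0 i) (qk.2.+1%:R^-1))).
    apply: fin_bigcap_measurable => // i _; rewrite -[X in measurable X]setTI.
    apply: measurable_rV_coord => //; apply: open_measurable.
    exact: ball_open.
  by apply/seteqP; split=> x /= Bx i; [move=> _|]; exact: Bx.
rewrite (_ : U = \bigcup_(qk in [set qk | B qk `<=` U]) B qk); last first.
  apply/seteqP; split=> [x Ux|x [qk]/=]; last exact.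
  have /nbhs_ballP[e /= e0 eU] : nbhs x U by exact: open_nbhs_nbhs.
  have [k ke] : exists k, k.+1%:R^-1 < e / 2.
    have e20 : 0 < e / 2 by rewrite divr_gt0.
    have [k _ /(_ k (leqnn k))] := near_infty_natSinv_lt (PosNum e20).
    by exists k.
  have qx i : exists q : rat, ball (x ord0 i) (k.+1%:R^-1) (ratr q : R).
    have b0 : ball (x ord0 i) (k.+1%:R^-1 : R) !=set0.
      by exists (x ord0 i); apply: ballxx.
    have [y [yx [q _ qy]]] := dense_rat b0 (ball_open _ _).
    by exists q; rewrite qy.
  pose q : 'rV[rat]_n := \row_i sval (cid (qx i)).
  have Bx : B (q, k) x.
    by move=> i; apply: ball_sym; rewrite /c !mxE; exact: (svalP (cid (qx i))).
  exists (q, k) => //= y By; apply: eU; split => // i j.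
  rewrite (ord1 i) (splitr e); apply: (@ball_triangle _ _ (c (q, k) ord0 j)).
    by apply: ball_sym; apply: le_ball (Bx j); exact: ltW.
  by apply: le_ball (By j); exact: ltW.
rewrite bigcup_mkcond; apply: countable_bigcupT_measurable => // qk.
by case: ifP.
Qed.

Section lebesgue_rV.
Context {R : realType}.
Local Open Scope ereal_scope.

Definition cons_rV n (z : measurableTypeR R * 'rV[R]_n) : 'rV[R]_n.+1 :=
  row_mx z.1%:M z.2.

Fixpoint lebesgue_rV n : set 'rV[R]_n -> \bar R :=
  if n is m.+1 then pushforward (lebesgue_measure \x @lebesgue_rV m) (@cons_rV m)
  else \d_(0%R : 'rV[R]_0).

Lemma cons_rV0 n (z : measurableTypeR R * 'rV[R]_n) :
  cons_rV z ord0 ord0 = z.1.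
Proof.
rewrite /cons_rV; have -> : (ord0 : 'I_n.+1) = lshift n (ord0 : 'I_1).
  exact/val_inj.
by rewrite (@row_mxEl _ 1 1 n) mxE eqxx mulr1n.
Qed.

Lemma cons_rVS n (z : measurableTypeR R * 'rV[R]_n) (i : 'I_n) :
  cons_rV z ord0 (lift ord0 i) = z.2 ord0 i.
Proof.
rewrite /cons_rV; have -> : lift ord0 i = rshift 1 i by exact/val_inj.
by rewrite (@row_mxEr _ 1 1 n).
Qed.

Lemma measurable_cons_rV n : measurable_fun setT (@cons_rV n).
Proof.
apply/measurable_fun_rVP => i; have [j ->|->] := unliftP ord0 i.
  rewrite (_ : (fun x => _) = (fun y : 'rV[R]_n => y ord0 j) \o snd); last first.
    by apply/funext => z /=; rewrite cons_rVS.
  exact: (measurableT_comp (@measurable_rV_coord _ _ _ j)).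
rewrite (_ : (fun x => _) = fst); first exact: measurable_fst.
by apply/funext => z /=; rewrite cons_rV0.
Qed.

Lemma lebesgue_rV_sigma_finite_measure n :
  exists mu : {sigma_finite_measure set 'rV[R]_n -> \bar R},
    @lebesgue_rV n = mu.
Proof.
elim: n => [|n [mu muE]].
  by exists [the {sigma_finite_measure set _ -> \bar R} of \d_(0%R : 'rV[R]_0)].
pose P := lebesgue_measure \x mu.
have P0 : @lebesgue_rV n.+1 set0 = 0.
  by rewrite /= muE /pushforward preimage_set0 measure0.
have Pge0 A : 0 <= @lebesgue_rV n.+1 A.
  by rewrite /= muE /pushforward measure_ge0.
have Psigma : semi_sigma_additive (@lebesgue_rV n.+1).
  move=> F mF tF mUF; rewrite /= muE /pushforward preimage_bigcup.
  have mpre A : measurable A -> measurable (@cons_rV n @^-1` A).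
    by move=> mA; rewrite -[X in measurable X]setTI; exact: measurable_cons_rV.
  apply: (@measure_semi_sigma_additive _ _ _ P) => //=.
  - by move=> k; exact: mpre.
  - apply/trivIsetP => i j _ _ ij; rewrite -preimage_setI.
    by move/trivIsetP : tF => /(_ _ _ _ _ ij) ->//; rewrite preimage_set0.
  - by rewrite -preimage_bigcup; exact: mpre.
pose nu0 := isMeasure.Build _ _ _ (@lebesgue_rV n.+1) P0 Pge0 Psigma.
pose nu : {measure set 'rV[R]_n.+1 -> \bar R} := HB.pack (@lebesgue_rV n.+1) nu0.
have sf : sigma_finite setT nu.
  have /sigma_finiteP[F [TF ndF Foo]] := sigma_finiteT (@lebesgue_measure R).
  have /sigma_finiteP[G [TG ndG Goo]] := sigma_finiteT mu.
  pose hd (x : 'rV[R]_n.+1) : measurableTypeR R := x ord0 ord0.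
  pose tl (x : 'rV[R]_n.+1) : 'rV[R]_n := \row_i x ord0 (lift ord0 i).
  have mhd : measurable_fun setT hd by exact: measurable_rV_coord.
  have mtl : measurable_fun setT tl.
    apply/measurable_fun_rVP => i.
    rewrite (_ : (fun x => _) = (fun x : 'rV[R]_n.+1 => x ord0 (lift ord0 i))).
      exact: measurable_rV_coord.
    by apply/funext => x; rewrite mxE.
  have hdK z : hd (cons_rV z) = z.1 by exact: cons_rV0.
  have tlK z : tl (@cons_rV n z) = z.2.
    by apply/rowP => i; rewrite mxE cons_rVS.
  exists (fun k => hd @^-1` F k `&` tl @^-1` G k).
    apply/seteqP; split=> // x _.
    have [k1 _ Fk] : (\bigcup_i F i) (hd x) by rewrite -TF.
    have [k2 _ Gk] : (\bigcup_i G i) (tl x) by rewrite -TG.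
    exists (maxn k1 k2) => //; split.
    - rewrite /=; move: (hd x) Fk; exact/subsetPset/ndF/leq_maxl.
    - rewrite /=; move: (tl x) Gk; exact/subsetPset/ndG/leq_maxr.
  move=> k; have [mF Fk] := Foo k; have [mG Gk] := Goo k.
  split.
    apply: measurableI.
      by rewrite -[X in measurable X]setTI; exact: mhd.
    by rewrite -[X in measurable X]setTI; exact: mtl.
  rewrite /= muE /pushforward.
  rewrite (_ : _ @^-1` _ = F k `*` G k).
    by rewrite product_measure1E// lte_mul_pinfty// ge0_fin_numE.
  by apply/seteqP; split=> z /=; rewrite hdK tlK.
pose nu1 := Measure_isSigmaFinite.Build _ _ _ nu sf.
pose nu2 : {sigma_finite_measure set 'rV[R]_n.+1 -> \bar R} :=
  HB.pack (@lebesgue_rV n.+1) nu0 nu1.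
by exists nu2.
Qed.

Let lebesgue_rV_spec n := projT2 (cid (lebesgue_rV_sigma_finite_measure n)).

Let lebesgue_rV0 n : @lebesgue_rV n set0 = 0.
Proof. by rewrite lebesgue_rV_spec measure0. Qed.

Let lebesgue_rV_ge0 n A : 0 <= @lebesgue_rV n A.
Proof. by rewrite lebesgue_rV_spec measure_ge0. Qed.

Let lebesgue_rV_sigma_additive n : semi_sigma_additive (@lebesgue_rV n).
Proof. by rewrite lebesgue_rV_spec; exact: measure_semi_sigma_additive. Qed.

HB.instance Definition _ n := isMeasure.Build _ _ _ (@lebesgue_rV n)
  (@lebesgue_rV0 n) (@lebesgue_rV_ge0 n) (@lebesgue_rV_sigma_additive n).

Let lebesgue_rV_sigma_finite n : sigma_finite setT (@lebesgue_rV n).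
Proof. by rewrite lebesgue_rV_spec; exact: sigma_finiteT. Qed.

HB.instance Definition _ n := Measure_isSigmaFinite.Build _ _ _ (@lebesgue_rV n)
  (@lebesgue_rV_sigma_finite n).

Lemma lebesgue_rV_box n (A : 'I_n -> set (measurableTypeR R)) :
  (forall i, measurable (A i)) ->
  lebesgue_rV [set x : 'rV[R]_n | forall i, A i (x ord0 i)] =
  \prod_(i < n) lebesgue_measure (A i).
Proof.
elim: n A => [|n ih] A mA.
  by rewrite big_ord0 /= diracE mem_set//= => -[].
rewrite big_ord_recl -ih// /= /pushforward -product_measure1E//.
  congr (_ _); apply/seteqP; split=> z /=.
    move=> Az; split; first by rewrite -(cons_rV0 z).
    by move=> i; rewrite -cons_rVS.
  move=> [A0 AS] i; have [j ->|->] := unliftP ord0 i.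
    by rewrite cons_rVS.
  by rewrite cons_rV0.
rewrite (_ : mkset _ = \bigcap_(i in [set: 'I_n])
    ((fun x : 'rV[R]_n => x ord0 i) @^-1` A (lift ord0 i))).
  apply: fin_bigcap_measurable => // i _.
  rewrite -[X in measurable X]setTI.
  exact: (@measurable_rV_coord _ _ n i measurableT _ (mA (lift ord0 i))).
by apply/seteqP; split=> x /= Ax i; [move=> _|]; exact: Ax.
Qed.

End lebesgue_rV.

Arguments lebesgue_rV {R} n.

Section vector_fields.
Context {R : realType} {n : nat}.
Implicit Types (g : 'rV[R]_n -> R) (X : 'rV[R]_n -> 'rV[R]_n).

Definition partial (i : 'I_n) g : 'rV[R]_n -> R :=
  fun x => 'D_(delta_mx ord0 i) g x.

(* The vector field \sum_i a_i(x) d/dx_i is encoded by its coefficients, that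
   is, by the map X : x |-> (a_1(x), ..., a_n(x)). *)
Definition vf_apply X g : 'rV[R]_n -> R :=
  fun x => \sum_(i < n) X x ord0 i * partial i g x.

Definition divergence X : 'rV[R]_n -> R :=
  fun x => \sum_(i < n) partial i (fun y => X y ord0 i) x.

Definition vf_adjoint X g : 'rV[R]_n -> R :=
  fun x => - vf_apply X g x - divergence X x * g x.

Definition sublaplacian m (X : 'I_m -> 'rV[R]_n -> 'rV[R]_n) g :
    'rV[R]_n -> R :=
  fun x => - \sum_(k < m) vf_adjoint (X k) (vf_apply (X k) g) x.

End vector_fields.

Section test_functions.
Context {R : realType} {n : nat}.
Implicit Types (g : 'rV[R]_n -> R) (K : set 'rV[R]_n).

Fixpoint Ck (k : nat) g : Prop :=
  continuous g /\
  (if k is k'.+1 then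
    forall i : 'I_n,
      (forall x, derivable g x (delta_mx ord0 i)) /\ Ck k' (partial i g)
  else True).

Definition Ck_supp k K g := Ck k g /\ forall x, ~ K x -> g x = 0.

(* For g of class C^k, the C^k norm of g (the supremum over R^n of the absolute
   values of the partial derivatives of g of order at most k) is at most e. *)
Fixpoint Ck_norm_le (k : nat) (e : R) g : Prop :=
  (forall x, `|g x| <= e) /\
  (if k is k'.+1 then forall i : 'I_n, Ck_norm_le k' e (partial i g) else True).

Definition time_co (T : \bar R) : set R := [set t | 0 <= t /\ (t%:E < T)%E].

Definition time_oo (T : \bar R) : set R := [set t | 0 < t /\ (t%:E < T)%E].

(* psi : [0, T[ -> C^2_c(R^n) is continuously differentiable with compact
   support, where C^2_c(R^n) carries its usual inductive limit topology: as the
   support in time is compact, all psi t are supported in a common compact K,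
   and derivation and continuity are those of the C^2 norm. The values of psi
   outside of [0, T[ are irrelevant; at t = 0 the derivative is one-sided. *)
Definition C1c_C2c (T : \bar R) (psi : R -> 'rV[R]_n -> R) : Prop :=
  exists (K : set 'rV[R]_n) (tau : R) (dpsi : R -> 'rV[R]_n -> R),
  [/\ compact K /\ (tau%:E < T)%E,
      forall t, time_co T t -> Ck_supp 2 K (psi t) /\ Ck_supp 2 K (dpsi t),
      forall t, time_co T t -> tau < t -> forall x, psi t x = 0,
      forall t, time_co T t -> forall e, 0 < e -> \forall h \near 0^',
        time_co T (t + h) ->
        Ck_norm_le 2 e (fun x => h^-1 * (psi (t + h) x - psi t x) - dpsi t x) &
      forall t, time_co T t -> forall e, 0 < e -> \forall s \near t,
        time_co T s -> Ck_norm_le 2 e (fun x => dpsi s x - dpsi t x)].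

End test_functions.

Section weak_solutions.
Context {R : realType} {n : nat}.

Definition L1loc (g : 'rV[R]_n -> R) : Prop :=
  measurable_fun setT g /\
  forall K, compact K -> (\int[lebesgue_rV n]_(x in K) `|(g x)%:E| < +oo)%E.

Definition spacetime_measure :
    {measure set (measurableTypeR R * 'rV[R]_n)%type -> \bar R} :=
  (@lebesgue_measure R \x lebesgue_rV n)%E.

Definition Lploc_Lploc (T : \bar R) (p : R) (u : R -> 'rV[R]_n -> R) : Prop :=
  measurable_fun (time_oo T `*` setT : set (measurableTypeR R * 'rV[R]_n))
    (fun z => u z.1 z.2) /\
  forall (I : set R) (K : set 'rV[R]_n),
    compact I -> I `<=` time_oo T -> compact K ->
    (\int[spacetime_measure]_(z in I `*` K) (`|u z.1 z.2| `^ p)%:E < +oo)%E.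

(* Weak solutions on [0, T[ of u_t - Delta_X u = |u|^p + f, u(0, .) = u0. As u
   is p-integrable only locally in the open interval ]0, T[, the integrals
   involving u may diverge at t = 0 and their convergence is part of the
   identity (those of u0 psi(0, .) and f psi converge since u0 and f are
   locally integrable). *)
Definition weak_solution (T : \bar R) (p : R) m
    (X : 'I_m -> 'rV[R]_n -> 'rV[R]_n) (f u0 : 'rV[R]_n -> R)
    (u : R -> 'rV[R]_n -> R) : Prop :=
  let Q : set (measurableTypeR R * 'rV[R]_n) := time_oo T `*` setT in
  Lploc_Lploc T p u /\
  forall psi : R -> 'rV[R]_n -> R, C1c_C2c T psi ->
    (forall t x, time_co T t -> 0 <= psi t x) ->
    let psi_t := fun t x => derive1 (fun s => psi s x) t in
    let Delta_psi := fun t x => sublaplacian X (psi t) x in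
    [/\ spacetime_measure.-integrable Q
          (fun z => (`|u z.1 z.2| `^ p * psi z.1 z.2)%:E),
        spacetime_measure.-integrable Q
          (fun z => (u z.1 z.2 * psi_t z.1 z.2)%:E),
        spacetime_measure.-integrable Q
          (fun z => (u z.1 z.2 * Delta_psi z.1 z.2)%:E) &
        \int[spacetime_measure]_(z in Q) (`|u z.1 z.2| `^ p * psi z.1 z.2)
        + \int[lebesgue_rV n]_x (u0 x * psi 0 x)
        + \int[spacetime_measure]_(z in Q) (f z.2 * psi z.1 z.2)
        + \int[spacetime_measure]_(z in Q) (u z.1 z.2 * psi_t z.1 z.2)
        + \int[spacetime_measure]_(z in Q) (u z.1 z.2 * Delta_psi z.1 z.2)
        = 0].

Definition global_weak_solution (p : R) m
    (X : 'I_m -> 'rV[R]_n -> 'rV[R]_n) (f u0 : 'rV[R]_n -> R)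
    (u : R -> 'rV[R]_n -> R) : Prop :=
  weak_solution +oo%E p X f u0 u.

End weak_solutions.

Section the_vector_fields.
Context {R : realType} {n : nat}.

(* X_1 = d/dx_1; coordinates are numbered from 0. *)
Definition X1 (x : 'rV[R]_n) : 'rV[R]_n := \row_(j < n) (j == 0%N :> nat)%:R.

(* X_2 = \sum_(1 <= i < n) x_i d/dx_(i+1): the j-th coefficient is the
   coordinate preceding the j-th one, and 0 for the first one. *)
Definition X2 (x : 'rV[R]_n) : 'rV[R]_n :=
  \row_(j < n) \sum_(i < n | i.+1 == j :> nat) x ord0 i.

Definition X12 (k : 'I_2) : 'rV[R]_n -> 'rV[R]_n :=
  if k == ord0 then X1 else X2.

End the_vector_fields.

(* Main.v *)
(** Test-function method. The fields are homogeneous of degree 1 for the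
    dilations x_i |-> s^i x_i, of homogeneous dimension Q = n(n+1)/2. Take

      psi(t, x) = b((t - s^2)/s^2) prod_i b(x_i / s^i),
      b(y) = ((1 - y^2)_+)^(l+3) = c(y)^(l+3),

    and P = c((t - s^2)/s^2) prod_i c(x_i / s^i), so that psi = P^(l+3). Then
    |psi_t| + |Delta_X psi| <= C s^-2 P^(l+1), and for l large Young's
    inequality gives

      |u| C s^-2 P^(l+1) <= |u|^p psi + (C s^-2)^q,   q = p/(p-1),

    on the support, whose volume is of order s^(2+Q). As psi(0, .) = 0, the
    weak formulation yields \int\int f psi <= C' s^(2 + Q - 2q), whereas
    \int\int f psi >= c s^2 for s large because \int f > 0. Finally p < Q/(Q-2)
    is exactly 2q > Q: contradiction as s -> oo. *)
Require Import Defs.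
From mathcomp Require Import all_boot all_order all_algebra.
From mathcomp Require Import all_classical all_reals all_analysis.
From mathcomp Require Import measurable_realfun zify ring lra.

Set Implicit Arguments.
Unset Strict Implicit.
Unset Printing Implicit Defensive.
Import Order.TTheory GRing.Theory Num.Theory.
Import numFieldNormedType.Exports.

Local Open Scope classical_set_scope.
Local Open Scope ring_scope.

Lemma is_derive_cvg (R : realType) (V : normedModType R) (f : V -> R) (a v : V)
    (l : R) :
  h^-1 * (f (h *: v + a) - f a) @[h --> 0^'] --> l -> is_derive a v f l.
Proof. by move=> fl; split; [exact: (cvgP l)|exact: cvg_lim]. Qed.

(** * The one-variable profile [(1 - y^2)_+^(l+3)] and its first two derivatives *)

Section profile.
Context {R : realType}.
Implicit Types (s t y : R) (k l : nat).

Definition pospow k y : R := Num.max 0 y ^+ k.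

Lemma continuous_pospow k : continuous (pospow k).
Proof.
move=> y; apply: (@continuous_comp R R R (fun z => Num.max 0 z) (fun z => z ^+ k)).
  by apply: (@continuous_max _ _ (cst 0) id) => //; exact: cvg_cst.
exact: exprn_continuous.
Qed.

Lemma mul_pospow k y : y * pospow k.+1 y = pospow k.+2 y.
Proof.
rewrite /pospow; case: (leP 0 y) => y0; first by rewrite [in RHS]exprS.
by rewrite !expr0n mulr0.
Qed.

(** Induction on [k]: the step is the product rule for [y * pospow k.+2 y], and only the square of
    the positive part needs a difference quotient, whose error is at most [|h|]. *)
Lemma is_derive_pospow k y :
  is_derive y 1 (pospow k.+2) (k.+2%:R * pospow k.+1 y).
Proof.
elim: k y => [|k ih] y.
  apply: is_derive_cvg; apply/cvgrPdist_le => e e0; near=> h.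
  have h0 : h != 0 by near: h; exact: nbhs_dnbhs_neq.
  have he : `|h| <= e.
    near: h; apply: dnbhs0_le => //.
  apply: le_trans he; rewrite /pospow !expr1 -mulr_natl.
  (* Multiplying by [|h|] clears the quotient; it remains to bound [2 h B - (A^2 - B^2)] by [h^2],
     according to the signs of [y] and [h + y]. *)
  rewrite [h *: 1]mulr1 -(@ler_pM2l _ `|h|) ?normr_gt0// -!normrM.
  set A := Num.max 0 (h + y); set B := Num.max 0 y.
  have -> : h * (2 * 1 * B - h^-1 * (A ^+ 2 - B ^+ 2)) =
      2 * h * B - (A ^+ 2 - B ^+ 2) by field.
  rewrite [leRHS]ger0_norm ?sqr_ge0// ler_norml /A /B.
  case: (leP 0 y) => ?; case: (leP 0 (h + y)) => ?; apply/andP; split; nra.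
have -> : pospow k.+3 = id * pospow k.+2.
  by apply/funext => z; rewrite -mul_pospow.
have H := is_deriveM (is_derive_id y 1) (ih y).
apply: (is_derive_eq H).
rewrite /= /GRing.scale /= mulrCA mul_pospow mulr1.
by rewrite -[k.+3%:R]natr1; ring.
Unshelve. all: by end_near.
Qed.

(* The index [k] selects the [k]-th derivative, for [k <= 2]. *)
Definition profile l k y : R :=
  match k with
  | 0 => pospow l.+3 (1 - y ^+ 2)
  | 1 => l.+3%:R * pospow l.+2 (1 - y ^+ 2) * (- 2 * y)
  | _ => l.+3%:R * l.+2%:R * pospow l.+1 (1 - y ^+ 2) * (4 * y ^+ 2)
         - 2 * l.+3%:R * pospow l.+2 (1 - y ^+ 2)
  end.

Let w y : R := 1 - y ^+ 2.

Let is_derive_w y : is_derive y 1 w (- 2 * y).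
Proof.
rewrite /w.
have -> : (fun y : R => 1 - y ^+ 2) = cst 1 - id ^+ 2 by [].
apply: is_derive_eq => /=.
rewrite /GRing.scale /=; ring.
Qed.

Let is_derive_pospow_w k y :
  is_derive y 1 (fun y => pospow k.+2 (w y)) (k.+2%:R * pospow k.+1 (w y) * (- 2 * y)).
Proof.
exact: (@is_derive1_comp _ (pospow k.+2) w y _ _
  (is_derive_pospow k (w y)) (is_derive_w y)).
Qed.

Lemma is_derive_profile l k y :
  (k < 2)%N -> is_derive y 1 (profile l k) (profile l k.+1 y).
Proof.
case: k => [|[|//]] _; first exact: is_derive_pospow_w.
have -> : profile l 1 = l.+3%:R *: ((fun y => pospow l.+2 (w y)) * ((- 2) *: id)).
  by apply/funext => z; rewrite /= -mulrA.
have H := is_deriveZ l.+3%:R (is_deriveM (is_derive_pospow_w l y)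
  (is_deriveZ (- 2) (is_derive_id y 1))).
apply: (is_derive_eq H); rewrite /= /GRing.scale /= -/(w y).
ring.
Qed.

Lemma continuous_profile l k : continuous (profile l k).
Proof.
have cw : continuous w.
  by move=> y; apply: cvgB; [exact: cvg_cst|exact: exprn_continuous].
have cp j : continuous (fun y => pospow j (w y)).
  by move=> y; apply: (continuous_comp (cw y)); exact: continuous_pospow.
have cs : continuous (fun y : R => 4 * y ^+ 2).
  by move=> y; apply: cvgM; [exact: cvg_cst|exact: exprn_continuous].
case: k => [|[|k]] y /=; first exact: cp.
- apply: cvgM; apply: cvgM; [exact: cvg_cst|exact: cp|exact: cvg_cst|exact: cvg_id].
- apply: cvgB; apply: cvgM; [|exact: cs|exact: cvg_cst|exact: cp].
  by apply: cvgM; [exact: cvg_cst|exact: cp].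
Qed.

Definition cutoff y : R := pospow 1 (1 - y ^+ 2).

Lemma cutoff_ge0 y : 0 <= cutoff y.
Proof. by rewrite /cutoff /pospow expr1 le_max lexx. Qed.

Lemma cutoff_le1 y : cutoff y <= 1.
Proof. by rewrite /cutoff /pospow expr1 ge_max ler01/= gerBl sqr_ge0. Qed.

Lemma cutoff_eq0 y : 1 <= `|y| -> cutoff y = 0.
Proof.
move=> y1; rewrite /cutoff /pospow expr1; apply/max_idPl.
by rewrite subr_le0 -real_normK ?num_real// exprn_ege1.
Qed.

Lemma cutoffX k y : pospow k (1 - y ^+ 2) = cutoff y ^+ k.
Proof. by rewrite /cutoff /pospow expr1. Qed.

Lemma profile0E l y : profile l 0 y = cutoff y ^+ l.+3.
Proof. by rewrite /= cutoffX. Qed.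

(** With [N = l + 3], the second derivative is the worst case: on [|y| <= 1] its constants satisfy
    [4 N (N - 1) + 2 N <= 6 N^2]. *)
Definition profile_bound l : R := 6 * l.+3%:R ^+ 2.

Lemma profile_bound_ge1 l : 1 <= profile_bound l.
Proof.
have : 1 <= l.+3%:R :> R by rewrite ler1n.
rewrite /profile_bound; nra.
Qed.

(** Each differentiation costs one power of [cutoff], so at least [l + 1] powers survive in every
    case. *)
Lemma profile_le l k y :
  `|profile l k y| <= profile_bound l * cutoff y ^+ l.+1.
Proof.
have c0 := cutoff_ge0 y; have c1 := cutoff_le1 y.
have N3 : 3 <= l.+3%:R :> R by rewrite ler_nat.
have N2 : 0 <= (l.+2%:R : R) <= l.+3%:R by rewrite ler0n ler_nat /=.
have [y1|y1] := leP 1 `|y|.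
  by case: k => [|[|k]]; rewrite /= ?cutoffX (cutoff_eq0 y1) !expr0n/=
    ?(mulr0, mul0r, subr0) normr0.
have y2 : 0 <= y ^+ 2 <= 1.
  by rewrite sqr_ge0 -real_normK ?num_real// exprn_ile1// ltW.
have yb : - 1 <= y <= 1 by rewrite -ler_norml ltW.
have P0 : 0 <= cutoff y ^+ l.+1 by rewrite exprn_ge0.
case: k => [|[|k]]; rewrite /= ?cutoffX /profile_bound.
- rewrite ger0_norm ?exprn_ge0// [_ ^+ l.+3]exprSr [_ ^+ l.+2]exprSr.
  set P := cutoff y ^+ l.+1 in P0 *; set c := cutoff y in c0 c1 *.
  have h1 : P * (c * c) <= P by rewrite ler_piMr// mulr_ile1.
  have h2 : 1 <= 6 * l.+3%:R ^+ 2 :> R by nra.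
  by rewrite -mulrA (le_trans h1)// ler_peMl.
- rewrite [cutoff y ^+ l.+2]exprSr.
  set P := cutoff y ^+ l.+1 in P0 *; set c := cutoff y in c0 c1 *.
  have PC0 : 0 <= l.+3%:R * (P * c) by rewrite !mulr_ge0.
  rewrite normrM (ger0_norm PC0) mulNr normrN normrM ger0_norm//.
  have y1' := ltW y1; have := normr_ge0 y.
  have NP0 : 0 <= l.+3%:R * P by rewrite mulr_ge0//; lra.
  have h1 : l.+3%:R * (P * c) <= l.+3%:R * P by rewrite mulrA ler_piMr.
  have h2 : l.+3%:R * P <= l.+3%:R ^+ 2 * P by rewrite expr2; nra.
  have h3 : l.+3%:R * (P * c) * (2 * `|y|) <= l.+3%:R * P * 2.
    by apply: ler_pM => //; nra.
  nra.
- rewrite [cutoff y ^+ l.+2]exprSr.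
  set P := cutoff y ^+ l.+1 in P0 *; set c := cutoff y in c0 c1 *.
  set N := l.+3%:R in N2 N3 *; set M := l.+2%:R in N2 *.
  have NP0 : 0 <= N * P by rewrite mulr_ge0//; lra.
  have N2P : N * P <= N ^+ 2 * P by rewrite expr2; nra.
  have h1 : 0 <= N * (P * c) <= N * P.
    by rewrite mulrA ler_piMr// mulr_ge0.
  have NMP0 : 0 <= N * M * P by rewrite !mulr_ge0//; lra.
  have h2 : N * M * P <= N ^+ 2 * P by rewrite ler_wpM2r// expr2; nra.
  have h3 : 0 <= N * M * P * (y ^+ 2) <= N * M * P.
    by rewrite mulr_ge0 ?sqr_ge0//= ler_piMr//; lra.
  rewrite -mulrA -mulrA ler_norml; apply/andP; split; nra.
Qed.

End profile.

(** * Translates and dilates of the profile *)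

Section dilated_profile.
Context {R : realType}.
Implicit Types (c r t : R) (k l : nat).

(** [c] is the centre and [r] the radius of the support; the factor [r^-k] comes from the chain
    rule, so that [k] still counts derivatives. *)
Definition bump c r l k t : R := r^-1 ^+ k * profile l k ((t - c) / r).

Lemma is_derive_bump c r l k t :
  (k < 2)%N -> is_derive t 1 (bump c r l k) (bump c r l k.+1 t).
Proof.
move=> k2.
have Dw : is_derive t 1 (fun t => (t - c) / r) r^-1.
  have -> : (fun t => (t - c) / r) = r^-1 *: (id - cst c).
    by apply/funext => z; rewrite [LHS]mulrC.
  have H := is_deriveZ r^-1 (is_deriveB (is_derive_id t 1) (is_derive_cst c t 1)).
  apply: (is_derive_eq H); rewrite /GRing.scale /=; ring.
have H := @is_derive1_comp _ (profile l k) _ t _ _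
  (is_derive_profile l ((t - c) / r) k2) Dw.
apply: (is_derive_eq (is_deriveZ (r^-1 ^+ k) H)).
by rewrite /bump exprSr -[RHS]mulrA [X in _ = _ * X]mulrC.
Qed.

Lemma continuous_bump c r l k : continuous (bump c r l k).
Proof.
move=> t; apply: cvgM; first exact: cvg_cst.
apply: (@continuous_comp _ _ _ (fun t => (t - c) / r)); last first.
  exact: continuous_profile.
by apply: cvgM; [apply: cvgB; [exact: cvg_id|exact: cvg_cst]|exact: cvg_cst].
Qed.

Lemma bump_le c r l k t : 0 < r ->
  `|bump c r l k t| <= r^-1 ^+ k * profile_bound l * cutoff ((t - c) / r) ^+ l.+1.
Proof.
move=> r0; have rk : 0 <= r^-1 ^+ k by rewrite exprn_ge0 ?invr_ge0 ?ltW.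
by rewrite normrM ger0_norm// -mulrA ler_wpM2l// profile_le.
Qed.

Lemma bump0E c r l t : bump c r l 0 t = cutoff ((t - c) / r) ^+ l.+3.
Proof. by rewrite /bump expr0 mul1r profile0E. Qed.

Lemma bump0_ge0 c r l t : 0 <= bump c r l 0 t.
Proof. by rewrite bump0E exprn_ge0// cutoff_ge0. Qed.

Lemma bump_eq0 c r l k t : 0 < r -> r <= `|t - c| -> bump c r l k t = 0.
Proof.
move=> r0 rt; apply/normr0_eq0/eqP; rewrite eq_le normr_ge0 andbT.
apply: (le_trans (bump_le _ _ _ _ r0)); rewrite cutoff_eq0 ?expr0n ?mulr0//.
by rewrite normrM normfV (gtr0_norm r0) ler_pdivlMr// mul1r.
Qed.

End dilated_profile.

(** * Product bumps on [R^n] and their partial derivatives *)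

Section tensor_bump.
Context {R : realType} {n : nat}.
Variables (r : 'I_n -> R) (l : nat).
Implicit Types (a : 'I_n -> nat) (x : 'rV[R]_n).
Hypothesis r_ge1 : forall i, 1 <= r i.

(** [a] is a multi-index: as long as every [a i <= 2], this is the partial derivative of order [a]
    of the product of bumps. *)
Definition tbump a x : R := \prod_(i < n) bump 0 (r i) l (a i) (x ord0 i).

Definition incr (i : 'I_n) a : 'I_n -> nat := fun j => (a j + (j == i))%N.

(** Only the [i]-th factor depends on the [i]-th coordinate; the others form the constant [C] in the
    difference quotient. *)
Lemma is_derive_tbump (i : 'I_n) a x : (a i < 2)%N ->
  is_derive x (delta_mx ord0 i) (tbump a) (tbump (incr i a) x).
Proof.
move=> ai; pose b := bump 0 (r i) l.
pose C := \prod_(j < n | j != i) bump 0 (r j) l (a j) (x ord0 j).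
apply: is_derive_cvg.
have -> : (fun h => h^-1 * (tbump a (h *: delta_mx ord0 i + x) - tbump a x)) =
    (fun h => h^-1 *: (b (a i) (h *: 1 + x ord0 i) - b (a i) (x ord0 i)) * C).
  apply/funext => h; rewrite /tbump (bigD1 i)//= [in X in _ - X](bigD1 i)//=.
  rewrite (eq_bigr (fun j => bump 0 (r j) l (a j) (x ord0 j))); last first.
    by move=> j ji; rewrite !mxE (negbTE ji) mulr0 add0r.
  by rewrite !mxE !eqxx -mulrBl mulrA.
have -> : tbump (incr i a) x = b (a i).+1 (x ord0 i) * C.
  rewrite /tbump (bigD1 i)//= /incr eqxx addn1; congr (_ * _).
  by apply: eq_bigr => j ji; rewrite (negbTE ji) addn0.
apply: cvgM; last exact: cvg_cst.
have [d e] := is_derive_bump 0 (r i) l (x ord0 i) ai.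
by rewrite /b -e; exact: d.
Qed.

Lemma partial_tbump (i : 'I_n) a : (a i < 2)%N ->
  partial i (tbump a) = tbump (incr i a).
Proof.
by move=> ai; apply/funext => x; have [_ <-] := is_derive_tbump x ai.
Qed.

Lemma continuous_tbump a : continuous (tbump a).
Proof.
rewrite /tbump; elim: (index_enum _) => [|i s ih] x.
  under eq_fun do rewrite big_nil.
  exact: cst_continuous.
have ci : continuous (fun y : 'rV[R]_n => bump 0 (r i) l (a i) (y ord0 i)).
  move=> y; apply: (@continuous_comp 'rV[R]_n R R (fun y => y ord0 i)).
    exact: coord_continuous.
  exact: continuous_bump.
under eq_fun do rewrite big_cons.
exact: (cvgM (ci x) (ih x)).
Qed.

Definition xcutoff x : R := \prod_(i < n) cutoff (x ord0 i / r i).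

Lemma xcutoff_ge0 x : 0 <= xcutoff x.
Proof. by apply: prodr_ge0 => i _; exact: cutoff_ge0. Qed.

Lemma xcutoff_le1 x : xcutoff x <= 1.
Proof. by apply: prodr_ile1 => i _; rewrite cutoff_ge0 cutoff_le1. Qed.

(** The factors [(r i)^-1 ^+ a i] are kept because they will cancel the growth of the coefficients
    of the vector fields. *)
Lemma tbump_le a x : `|tbump a x| <=
  profile_bound l ^+ n * \prod_(i < n) (r i)^-1 ^+ a i * xcutoff x ^+ l.+1.
Proof.
rewrite normr_prod /xcutoff -prodrXl.
rewrite -[X in _ ^+ X]card_ord -prodr_const -!big_split/=.
apply: ler_prod => i _; rewrite normr_ge0/=.
have := bump_le 0 l (a i) (x ord0 i) (lt_le_trans ltr01 (r_ge1 i)).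
by rewrite subr0 [_ * profile_bound l]mulrC.
Qed.

Lemma xcutoff_eq0 x (i : 'I_n) : r i <= `|x ord0 i| -> xcutoff x = 0.
Proof.
move=> xi; rewrite /xcutoff (bigD1 i)//= cutoff_eq0 ?mul0r//.
have r0 := lt_le_trans ltr01 (r_ge1 i).
by rewrite normrM normfV (gtr0_norm r0) ler_pdivlMr// mul1r.
Qed.

Lemma tbump_eq0 a x (i : 'I_n) : r i <= `|x ord0 i| -> tbump a x = 0.
Proof.
move=> xi; apply/normr0_eq0/eqP; rewrite eq_le normr_ge0 andbT.
by apply: (le_trans (tbump_le _ _)); rewrite (xcutoff_eq0 xi) expr0n mulr0.
Qed.

Lemma tbump0E x : tbump (fun=> 0%N) x = xcutoff x ^+ l.+3.
Proof.
rewrite /tbump /xcutoff -prodrXl; apply: eq_bigr => i _.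
by rewrite bump0E subr0.
Qed.

(** Each partial derivative raises one [a i] and lowers [k]; the invariant [a i + k <= 2] stays
    within the range where [profile] is a genuine derivative. *)
Lemma Ck_tbump k a : (forall i, (a i + k <= 2)%N) -> Ck k (tbump a).
Proof.
elim: k a => [|k ih] a ak; first by split => //; exact: continuous_tbump.
split; first exact: continuous_tbump.
move=> i; have ai : (a i < 2)%N by have := ak i; lia.
split; first by move=> x; have [] := is_derive_tbump x ai.
rewrite partial_tbump//; apply: ih => j; have := ak j; rewrite /incr.
by case: (j == i); lia.
Qed.

(** The bound is uniform in the radii: [r i >= 1] makes the powers of [(r i)^-1] at most 1, and the
    cutoffs are at most 1. *)
Lemma Ck_norm_tbump k a : (forall i, (a i + k <= 2)%N) ->
  Ck_norm_le k (profile_bound l ^+ n) (tbump a).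
Proof.
have bd b x : `|tbump b x| <= profile_bound l ^+ n.
  apply: (le_trans (tbump_le _ _)).
  have A0 : 0 <= profile_bound l ^+ n :> R.
    by rewrite exprn_ge0// (le_trans ler01)// profile_bound_ge1.
  rewrite -mulrA ler_piMr// mulr_ile1 ?exprn_ge0 ?xcutoff_ge0//.
  - apply: prodr_ge0 => i _; rewrite exprn_ge0// invr_ge0.
    exact: le_trans (r_ge1 i).
  - apply: prodr_ile1 => i _.
    have r0 := lt_le_trans ltr01 (r_ge1 i).
    by rewrite exprn_ge0 ?invr_ge0 ?(ltW r0)//= exprn_ile1 ?invr_ge0 ?(ltW r0)// invf_le1.
  - by rewrite exprn_ile1 ?xcutoff_ge0// xcutoff_le1.
elim: k a => [|k ih] a ak; (split; first exact: bd) => // i.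
have ai : (a i < 2)%N by have := ak i; lia.
rewrite partial_tbump//; apply: ih => j; have := ak j; rewrite /incr.
by case: (j == i); lia.
Qed.

Definition xbox : set 'rV[R]_n := [set x | forall i, `[- r i, r i]%classic (x ord0 i)].

Lemma compact_xbox : compact xbox.
Proof.
apply: (@rV_compact R n (fun i => `[- r i, r i]%classic)) => i.
exact: segment_compact.
Qed.

Lemma notin_xbox x : ~ xbox x -> exists i, r i <= `|x ord0 i|.
Proof.
move=> /existsNP[i xi]; exists i; rewrite leNgt; apply/negP => /ltW.
by rewrite ler_norml => H; apply: xi; rewrite /= in_itv.
Qed.

End tensor_bump.

(** * Scalar multiples, and admissibility of the separated test function *)

Section scaling.
Context {R : realType} {n : nat}.
Implicit Types (g : 'rV[R]_n -> R).

Lemma partial_scale (c : R) (i : 'I_n) g :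
  (forall x, derivable g x (delta_mx ord0 i)) ->
  partial i (fun x => c * g x) = fun x => c * partial i g x.
Proof.
move=> dg; apply/funext => x; rewrite /partial -[RHS]/(c *: _) -deriveZ//.
Qed.

Lemma Ck_scale k (c : R) g : Ck k g -> Ck k (fun x => c * g x).
Proof.
elim: k g => [|k ih] g [cg dg].
  by split => // x; exact: (cvgM (cvg_cst c) (cg x)).
split; first by move=> x; exact: (cvgM (cvg_cst c) (cg x)).
move=> i; have [dgi Cgi] := dg i; split; last first.
  by rewrite partial_scale//; exact: ih.
by move=> x; exact: (derivableZ (k := c) (dgi x)).
Qed.

Lemma Ck_norm_le_scale k (c e : R) g :
  Ck k g -> Ck_norm_le k e g -> Ck_norm_le k (`|c| * e) (fun x => c * g x).
Proof.
elim: k g => [|k ih] g [cg dg] [eg deg]; split => //.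
- by move=> x; rewrite normrM ler_wpM2l.
- by move=> x; rewrite normrM ler_wpM2l.
move=> i; have [dgi Cgi] := dg i; rewrite partial_scale//.
exact: ih Cgi (deg i).
Qed.

Lemma Ck_norm_le_mono k (e e' : R) g :
  e <= e' -> Ck_norm_le k e g -> Ck_norm_le k e' g.
Proof.
move=> ee'; elim: k g => [|k ih] g [eg deg]; split => //.
- by move=> x; exact: le_trans (eg x) ee'.
- by move=> x; exact: le_trans (eg x) ee'.
by move=> i; exact: (ih _ (deg i)).
Qed.

(* With center and radius both equal to [s], the time factor is supported in
   [0, 2 s] and vanishes at [t = 0], which removes the initial datum. *)
Definition test_fun (r : 'I_n -> R) (s : R) l t (x : 'rV[R]_n) : R :=
  bump s s l 0 t * tbump r l (fun=> 0%N) x.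

(** At each time the function is a scalar multiple of the fixed [phi], so every [C^2] norm involved
    is at most a scalar times [M]; the claims reduce to derivability and continuity of the time
    factor. *)
Lemma C1c_C2c_test (r : 'I_n -> R) s l :
  (forall i, 1 <= r i) -> 0 < s -> C1c_C2c +oo%E (test_fun r s l).
Proof.
move=> r1 s0; pose phi := tbump r l (fun=> 0%N).
pose M : R := profile_bound l ^+ n.
have M0 : 0 < M by rewrite exprn_gt0// (lt_le_trans ltr01)// profile_bound_ge1.
have C2 : Ck 2 phi by exact: Ck_tbump.
have N2 : Ck_norm_le 2 M phi by exact: Ck_norm_tbump.
have small (c e : R) : `|c| <= e / M -> Ck_norm_le 2 e (fun x => c * phi x).
  move=> ce; have := Ck_norm_le_scale c C2 N2; apply: Ck_norm_le_mono.
  by rewrite -ler_pdivlMr.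
exists (xbox r), (2 * s), (fun t x => bump s s l 1 t * phi x); split.
- by split; [exact: compact_xbox|rewrite ltry].
- have S (c : R) : Ck_supp 2 (xbox r) (fun x => c * phi x).
    split; first exact: Ck_scale.
    by move=> x /(notin_xbox)[i xi]; rewrite /phi (tbump_eq0 l r1 _ xi) mulr0.
  by move=> t _; split; exact: S.
- move=> t _ ts x; rewrite /test_fun bump_eq0 ?mul0r//.
  by rewrite ler_normr lerBrDr -mulr2n -mulr_natl ltW.
- move=> t _ e e0.
  have [d eD] := is_derive_bump s s l t (isT : (0 < 2)%N).
  have /cvgrPdist_le/(_ (e / M)) : h^-1 *: (bump s s l 0 (h *: 1 + t) -
     bump s s l 0 t) @[h --> 0^'] --> bump s s l 1 t by rewrite -eD; exact: d.
  move=> /(_ (divr_gt0 e0 M0)); apply: filterS => h hle _.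
  have -> : (fun x => h^-1 * (test_fun r s l (t + h) x - test_fun r s l t x)
                      - bump s s l 1 t * phi x)
     = (fun x => (h^-1 * (bump s s l 0 (t + h) - bump s s l 0 t)
                  - bump s s l 1 t) * phi x).
    by apply/funext => x; rewrite /test_fun -/phi -mulrBl mulrA -mulrBl.
  by apply: small; rewrite distrC; move: hle; rewrite [h *: 1]mulr1 (addrC h t).
- move=> t _ e e0.
  have /cvgrPdist_le/(_ (e / M)) := @continuous_bump _ s s l 1 t.
  move=> /(_ (divr_gt0 e0 M0)); apply: filterS => h hle _.
  have -> : (fun x => bump s s l 1 h * phi x - bump s s l 1 t * phi x)
     = (fun x => (bump s s l 1 h - bump s s l 1 t) * phi x).
    by apply/funext => x; rewrite mulrBl.
  by apply: small; rewrite distrC.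
Qed.

End scaling.

(** * The second-order operator of one homogeneous field, applied to a product bump *)

Section homogeneous_field.
Context {R : realType} {n : nat}.
Variables (r : 'I_n -> R) (l : nat) (s : R).
Implicit Types (x : 'rV[R]_n).
Hypothesis r_ge1 : forall i, 1 <= r i.
Hypothesis s_gt0 : 0 < s.

Let r_gt0 i : 0 < r i := lt_le_trans ltr01 (r_ge1 i).

Lemma prod_incr (i : 'I_n) a :
  \prod_(j < n) (r j)^-1 ^+ incr i a j = (r i)^-1 * \prod_(j < n) (r j)^-1 ^+ a j.
Proof.
under eq_bigr do rewrite /incr exprD.
rewrite big_split/= mulrC; congr (_ * _).
rewrite (bigD1 i)//= eqxx expr1 big1 ?mulr1// => j /negbTE ->.
by rewrite expr0.
Qed.

(** [d k j] is the constant derivative of the [j]-th coefficient along [x_k]. The two bounds express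
    homogeneity: applying [X] at the scales [r] gains a factor [s^-1]. The zero diagonal makes [X]
    divergence free. *)
Variable (X : 'rV[R]_n -> 'rV[R]_n) (d : 'I_n -> 'I_n -> R).
Hypothesis dX : forall k j x,
  is_derive x (delta_mx ord0 k) (fun y => X y ord0 j) (d k j).
Hypothesis X_le : forall x j, xbox r x -> `|X x ord0 j| <= r j / s.
Hypothesis d_le : forall k j, `|d k j| <= r j / (s * r k).
Hypothesis d_diag : forall j, d j j = 0.

Let phi := tbump r l (fun=> 0%N).
Let phi1 j := tbump r l (incr j (fun=> 0%N)).
Let phi2 k j := tbump r l (incr k (incr j (fun=> 0%N))).
Let A := profile_bound l ^+ n : R.

Let A_ge0 : 0 <= A.
Proof. by rewrite exprn_ge0// (le_trans ler01)// profile_bound_ge1. Qed.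

Let phi1_le j x : `|phi1 j x| <= A * (r j)^-1 * xcutoff r x ^+ l.+1.
Proof.
apply: (le_trans (tbump_le _ _ _ _)) => //.
rewrite prod_incr (eq_bigr (fun=> 1)) ?big1 ?mulr1//.
Qed.

Let phi2_le k j x : `|phi2 k j x| <= A * ((r k)^-1 * (r j)^-1) * xcutoff r x ^+ l.+1.
Proof.
apply: (le_trans (tbump_le _ _ _ _)) => //.
by rewrite !prod_incr [X in _ * (_ * (_ * X))]big1 ?mulr1.
Qed.

Lemma divergence_eq0 x : divergence X x = 0.
Proof.
rewrite /divergence big1// => j _; rewrite /partial.
by have [_ ->] := dX j j x.
Qed.

Lemma vf_apply_tbump :
  vf_apply X phi = fun x => \sum_(j < n) X x ord0 j * phi1 j x.
Proof.
by apply/funext => x; apply: eq_bigr => j _; rewrite partial_tbump.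
Qed.

Lemma is_derive_vf_apply_tbump k x :
  is_derive x (delta_mx ord0 k) (vf_apply X phi)
    (\sum_(j < n) (X x ord0 j * phi2 k j x + phi1 j x * d k j)).
Proof.
rewrite vf_apply_tbump.
have -> : (fun x => \sum_(j < n) X x ord0 j * phi1 j x)
    = \sum_(j < n) ((fun x => X x ord0 j) * phi1 j).
  by apply/funext => y; rewrite fct_sumE.
have D j : is_derive x (delta_mx ord0 k) (phi1 j) (phi2 k j x).
  by apply: is_derive_tbump; rewrite // /incr; case: eqP.
exact: is_derive_sum (fun j => is_deriveM (dX k j x) (D j)).
Qed.

Lemma vf_apply2_tbump x : vf_apply X (vf_apply X phi) x =
  \sum_(k < n) X x ord0 k *
    \sum_(j < n) (X x ord0 j * phi2 k j x + phi1 j x * d k j).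
Proof.
apply: eq_bigr => k _; congr (_ * _).
by rewrite /partial; have [_ ->] := is_derive_vf_apply_tbump k x.
Qed.

(** This lets the time factor leave the operator; derivability of [phi] and of [vf_apply X phi]
    allows the scalar through both applications of [X]. *)
Lemma vf_adjoint_tbump_scale (c : R) x :
  vf_adjoint X (vf_apply X (fun y => c * phi y)) x
  = c * vf_adjoint X (vf_apply X phi) x.
Proof.
have vfZ g : (forall (i : 'I_n) y, derivable g y (delta_mx ord0 i)) ->
    vf_apply X (fun y => c * g y) = fun y => c * vf_apply X g y.
  move=> dg; apply/funext => y; rewrite /vf_apply mulr_sumr.
  by apply: eq_bigr => i _; rewrite partial_scale// mulrCA.
rewrite vfZ; last first.
  by move=> i y; have [] := is_derive_tbump r l y (isT : (fun=> 0%N) i < 2)%N.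
rewrite /vf_adjoint vfZ; last first.
  by move=> i y; have [] := is_derive_vf_apply_tbump i y.
by rewrite divergence_eq0 !mul0r !subr0 mulrN.
Qed.

(** Expanding [X (X phi)] gives [n^2] pairs [(k, j)], each with one term in a second derivative of
    [phi] and one in a derivative of a coefficient. In both the radii cancel and [s^-2] remains. *)
Lemma vf_adjoint_le x : `|vf_adjoint X (vf_apply X phi) x| <=
  2 * n%:R ^+ 2 * A * s ^- 2 * xcutoff r x ^+ l.+1.
Proof.
rewrite /vf_adjoint divergence_eq0 mul0r subr0 normrN vf_apply2_tbump.
set P := xcutoff r x ^+ l.+1.
have P0 : 0 <= P by rewrite exprn_ge0// xcutoff_ge0.
have XP j : `|X x ord0 j| * P <= r j / s * P.
  have [bx|/(notin_xbox)[i xi]] := pselect (xbox r x).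
    by rewrite ler_wpM2r// X_le.
  by rewrite /P (xcutoff_eq0 r_ge1 xi) expr0n !mulr0.
have rk0 k : r k != 0 by rewrite gt_eqF.
have s0 : s != 0 by rewrite gt_eqF.
have H k j : `|X x ord0 k * (X x ord0 j * phi2 k j x + phi1 j x * d k j)| <=
   2 * A * s ^- 2 * P.
  have h1 : `|X x ord0 k * (X x ord0 j * phi2 k j x)| <= A * s ^- 2 * P.
    (* Off the box the bump vanishes, and on it [X_le] applies. *)
    have [bx|/(notin_xbox)[i xi]] := pselect (xbox r x); last first.
      rewrite /phi2 (tbump_eq0 l r_ge1 _ xi) !mulr0 normr0 !mulr_ge0//.
      by rewrite invr_ge0 exprn_ge0// ltW.
    rewrite !normrM mulrA.
    have -> : A * s ^- 2 * P =
       (r k / s) * (r j / s) * (A * ((r k)^-1 * (r j)^-1) * P).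
      by field; rewrite s0 !rk0.
    apply: ler_pM; [by rewrite mulr_ge0| by []| |exact: phi2_le].
    by apply: ler_pM => //; exact: X_le.
  have h2 : `|X x ord0 k * (phi1 j x * d k j)| <= A * s ^- 2 * P.
    have [bx|/(notin_xbox)[i xi]] := pselect (xbox r x); last first.
      rewrite /phi1 (tbump_eq0 l r_ge1 _ xi) mul0r !mulr0 normr0 !mulr_ge0//.
      by rewrite invr_ge0 exprn_ge0// ltW.
    rewrite !normrM.
    have -> : A * s ^- 2 * P =
       (r k / s) * ((A * (r j)^-1 * P) * (r j / (s * r k))).
      by field; rewrite s0 !rk0.
    apply: ler_pM; [by []|by rewrite mulr_ge0|exact: X_le|].
    by apply: ler_pM.
  rewrite mulrDr; apply: (le_trans (ler_normD _ _)); lra.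
apply: (le_trans (ler_norm_sum _ _ _)).
apply: (@le_trans _ _ (\sum_(k < n) \sum_(j < n) 2 * A * s ^- 2 * P)).
  apply: ler_sum => k _; rewrite mulr_sumr; apply: (le_trans (ler_norm_sum _ _ _)).
  by apply: ler_sum => j _; exact: H.
rewrite !sumr_const !card_ord -mulrnA -[_ *+ (n * n)]mulr_natr natrM.
by rewrite le_eqVlt; apply/orP; left; apply/eqP; ring.
Qed.

End homogeneous_field.

(** * The two fields of the theorem and their anisotropic radii *)

Section the_fields.
Context {R : realType} {n : nat}.
Implicit Types (x : 'rV[R]_n) (s : R).

Lemma is_derive_coord (k i : 'I_n) x :
  is_derive x (delta_mx ord0 k) (fun y : 'rV[R]_n => y ord0 i) (i == k)%:R.
Proof.
apply: is_derive_cvg.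
apply: (@cvg_trans _ ((fun=> (i == k)%:R : R) @ 0^')); last exact: cvg_cst.
apply: near_eq_cvg; near=> h.
have h0 : h != 0 by near: h; exact: nbhs_dnbhs_neq.
by rewrite !mxE eqxx addrK mulKf.
Unshelve. all: by end_near. Qed.

Lemma is_derive_X1 (k j : 'I_n) x :
  is_derive x (delta_mx ord0 k) (fun y => X1 y ord0 j) 0.
Proof.
have -> : (fun y : 'rV[R]_n => X1 y ord0 j) = cst (j == 0%N :> nat)%:R.
  by apply/funext => y; rewrite mxE.
exact: is_derive_cst.
Qed.

(** At most one index of the defining sum satisfies [i.+1 = j], and none does when [j = 0]. *)
Lemma X2_coord (j : 'I_n) : (exists i : 'I_n, (j = i.+1 :> nat) /\
   (fun y : 'rV[R]_n => X2 y ord0 j) = (fun y => y ord0 i)) \/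
   (j = 0%N :> nat /\ (fun y : 'rV[R]_n => X2 y ord0 j) = cst 0).
Proof.
case: j => -[|j] jn; [right|left].
  by split => //; apply/funext => y; rewrite mxE big_pred0.
exists (Ordinal (ltnW jn)); split => //; apply/funext => y; rewrite mxE.
by rewrite (big_pred1 (Ordinal (ltnW jn))).
Qed.

Lemma is_derive_X2 (k j : 'I_n) x :
  is_derive x (delta_mx ord0 k) (fun y => X2 y ord0 j) (k.+1 == j :> nat)%:R.
Proof.
have [[i [ji ->]]|[j0 ->]] := X2_coord j.
  rewrite ji eqSS eq_sym; exact: is_derive_coord.
by rewrite j0; exact: is_derive_cst.
Qed.

(** Indices start at 0, so the coordinate [i] has weight [i + 1] under the dilations. *)
Definition radius s (i : 'I_n) : R := s ^+ i.+1.

Lemma radius_ge1 s (i : 'I_n) : 1 <= s -> 1 <= radius s i.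
Proof. by move=> s1; exact: exprn_ege1. Qed.

Lemma sublaplacian_tbump_scale l s (c : R) x :
  sublaplacian X12 (fun y => c * tbump (radius s) l (fun=> 0%N) y) x =
  c * sublaplacian X12 (tbump (radius s) l (fun=> 0%N)) x.
Proof.
rewrite /sublaplacian mulrN mulr_sumr; congr (- _).
apply: eq_bigr => k _; rewrite /X12; case: ifP => _.
- exact: (vf_adjoint_tbump_scale _ _ is_derive_X1 (fun=> erefl)).
- apply: (vf_adjoint_tbump_scale _ _ is_derive_X2) => j.
  by rewrite gtn_eqF.
Qed.

(** Both fields meet the homogeneity bounds: the coefficient 1 of [X1] is [radius s 0 / s], and on
    the box the coefficient [x_(j-1)] of [X2] is at most [s^j], which is [radius s j / s]. *)
Lemma sublaplacian_tbump_le l s x : 1 <= s ->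
  `|sublaplacian X12 (tbump (radius s) l (fun=> 0%N)) x| <=
  4 * n%:R ^+ 2 * profile_bound l ^+ n * s ^- 2 * xcutoff (radius s) x ^+ l.+1.
Proof.
move=> s1; have s0 : 0 < s by rewrite (lt_le_trans ltr01).
have r1 i := radius_ge1 i s1.
have r0 i : 0 < radius s i by rewrite (lt_le_trans ltr01).
rewrite /sublaplacian normrN big_ord_recl big_ord1 /X12 /=.
apply: (le_trans (ler_normD _ _)).
have s_neq0 : s != 0 by rewrite gt_eqF.
have X1_le y (j : 'I_n) : xbox (radius s) y -> `|X1 y ord0 j| <= radius s j / s.
  move=> _; rewrite mxE /radius exprSr mulfK//.
  have [->|_] := eqVneq (j : nat) 0%N; first by rewrite expr0 normr1.
  by rewrite normr0 exprn_ge0// ltW.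
have X2_le y (j : 'I_n) : xbox (radius s) y -> `|X2 y ord0 j| <= radius s j / s.
  move=> bx; rewrite /radius exprSr mulfK//.
  have [[i [ji /(congr1 (@^~ y)) ->]]|[j0 /(congr1 (@^~ y)) ->]] := X2_coord j.
    by have := bx i; rewrite /radius /= in_itv/= -ler_norml ji.
  by rewrite normr0 exprn_ge0// ltW.
have d1_le (k j : 'I_n) : `|0 : R| <= radius s j / (s * radius s k).
  by rewrite normr0 divr_ge0 ?mulr_ge0// ltW.
(* For [j = k + 1] both sides equal 1; otherwise the left side is 0. *)
have d2_le (k j : 'I_n) : `|(k.+1 == j :> nat)%:R : R| <= radius s j / (s * radius s k).
  rewrite /radius -exprS; have [<-|_] := eqVneq k.+1 (j : nat).
    by rewrite normr1 divff// expf_neq0.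
  by rewrite normr0 divr_ge0 ?exprn_ge0// ltW.
have d2_diag (j : 'I_n) : (j.+1 == j :> nat)%:R = 0 :> R by rewrite gtn_eqF.
have H1 := vf_adjoint_le l r1 s0 is_derive_X1 X1_le d1_le (fun=> erefl) x.
have H2 := vf_adjoint_le l r1 s0 is_derive_X2 X2_le d2_le d2_diag x.
apply: (le_trans (lerD H1 H2)).
rewrite le_eqVlt; apply/orP; left; apply/eqP; ring.
Qed.

End the_fields.

(** * Pointwise lower bound for the weak integrand *)

Section pointwise.
Context {R : realType}.

(* Young's inequality; [P <= 1] turns [(P ^ (l + 1)) ^ p] into [P ^ (l + 3)]. *)
Lemma young_cutoff (p q w C P : R) (l : nat) :
  0 < p -> 0 < q -> p^-1 + q^-1 = 1 -> l.+3%:R <= l.+1%:R * p ->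
  0 <= w -> 0 <= C -> 0 <= P <= 1 ->
  w * (C * P ^+ l.+1) <= w `^ p * P ^+ l.+3 + C `^ q.
Proof.
move=> p0 q0 pq lp w0 C0 /andP[P0 P1].
have wP0 : 0 <= w * P ^+ l.+1 by rewrite mulr_ge0// exprn_ge0.
have p1 : p^-1 <= 1 by rewrite -pq lerDl invr_ge0 ltW.
have q1 : q^-1 <= 1 by rewrite -pq lerDr invr_ge0 ltW.
rewrite mulrCA mulrC; apply: (le_trans (conjugate_powR wP0 C0 p0 q0 pq)).
apply: lerD; last by rewrite ler_piMr// powR_ge0.
apply: (@le_trans _ _ ((w * P ^+ l.+1) `^ p)); first by rewrite ler_piMr// powR_ge0.
rewrite powRM// ?exprn_ge0// ler_wpM2l ?powR_ge0//.
(* For [0 < P <= 1] a larger exponent gives a smaller power, and [(l + 1) p >= l + 3]; [P = 0] is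
   treated apart. *)
move: P0; rewrite le_eqVlt => /predU1P[<-|P0].
  by rewrite !expr0n/= powR0// gt_eqF.
rewrite -(powR_mulrn _ (ltW P0)) -(powR_mulrn _ (ltW P0)) -powRrM.
by apply: ger_powR => //; rewrite P0 P1.
Qed.

Context {n : nat}.
Implicit Types (x : 'rV[R]_n) (s t : R).

Definition tcutoff s t : R := cutoff ((t - s) / s).

Definition stcutoff s t x : R := tcutoff (s ^+ 2) t * xcutoff (radius s) x.

Lemma stcutoff_itv s t x : 0 <= stcutoff s t x <= 1.
Proof.
rewrite /stcutoff mulr_ge0 ?cutoff_ge0 ?xcutoff_ge0//=.
by rewrite mulr_ile1 ?cutoff_ge0 ?xcutoff_ge0 ?cutoff_le1 ?xcutoff_le1.
Qed.

Lemma testE l s t x : test_fun (radius s) (s ^+ 2) l t x = stcutoff s t x ^+ l.+3.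
Proof. by rewrite /test_fun bump0E tbump0E -exprMn. Qed.

(** The first summand bounds the time derivative, the second the sublaplacian. *)
Definition decay_const l : R :=
  profile_bound l + 4 * n%:R ^+ 2 * profile_bound l ^+ n.

Lemma decay_const_ge0 l : 0 <= decay_const l.
Proof.
have b0 : 0 <= profile_bound l :> R by rewrite (le_trans ler01)// profile_bound_ge1.
by rewrite addr_ge0// !mulr_ge0// exprn_ge0.
Qed.

(** One derivative at the time scale [s^2] yields [s^-2]; the undifferentiated spatial factor gives
    up two powers so that both factors share the exponent [l + 1]. *)
Lemma test_t_le l s t x : 1 <= s ->
  `|derive1 (fun t => test_fun (radius s) (s ^+ 2) l t x) t| <=
  profile_bound l * s ^- 2 * stcutoff s t x ^+ l.+1.
Proof.
move=> s1; have s0 : 0 < s by rewrite (lt_le_trans ltr01).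
have -> : derive1 (fun t => test_fun (radius s) (s ^+ 2) l t x) t =
    tbump (radius s) l (fun=> 0%N) x * bump (s ^+ 2) (s ^+ 2) l 1 t.
  have H := is_deriveZ (tbump (radius s) l (fun=> 0%N) x)
    (is_derive_bump (s ^+ 2) (s ^+ 2) l t (isT : (0 < 2)%N)).
  rewrite derive1E.
  have -> : (fun t => test_fun (radius s) (s ^+ 2) l t x) =
      tbump (radius s) l (fun=> 0%N) x *: bump (s ^+ 2) (s ^+ 2) l 0.
    by apply/funext => z; rewrite /test_fun mulrC.
  by have [_ ->] := H.
have X0 := xcutoff_ge0 (radius s) x; have X1 := xcutoff_le1 (radius s) x.
rewrite normrM tbump0E ger0_norm ?exprn_ge0//.
have Xl : xcutoff (radius s) x ^+ l.+3 <= xcutoff (radius s) x ^+ l.+1.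
  by apply: ler_wiXn2l => //; rewrite leqW.
apply: (le_trans (ler_pM _ _ Xl (bump_le _ _ _ _ _))) => //.
- exact: exprn_ge0.
- exact: exprn_gt0.
by rewrite expr1 /stcutoff (exprMn _ (cutoff _)); lra.
Qed.

Lemma Delta_test_le l s t x : 1 <= s ->
  `|sublaplacian X12 (test_fun (radius s) (s ^+ 2) l t) x| <=
  4 * n%:R ^+ 2 * profile_bound l ^+ n * s ^- 2 * stcutoff s t x ^+ l.+1.
Proof.
move=> s1; rewrite /test_fun sublaplacian_tbump_scale normrM.
rewrite ger0_norm ?bump0_ge0// bump0E.
rewrite -/(tcutoff _ _).
have T0 : 0 <= tcutoff (s ^+ 2) t := cutoff_ge0 _.
have Tl : tcutoff (s ^+ 2) t ^+ l.+3 <= tcutoff (s ^+ 2) t ^+ l.+1.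
  by apply: ler_wiXn2l => //; [exact: cutoff_le1|rewrite leqW].
apply: (le_trans (ler_pM _ _ Tl (sublaplacian_tbump_le l x s1))) => //.
  exact: exprn_ge0.
by rewrite /stcutoff (exprMn _ (tcutoff _ _)) mulrCA.
Qed.

Definition stbox s : set (measurableTypeR R * 'rV[R]_n) :=
  `[0, 2 * s ^+ 2] `*` xbox (radius s).

Lemma stcutoff_eq0 s t x : 1 <= s -> ~ stbox s (t, x) -> stcutoff s t x = 0.
Proof.
move=> s1 /not_andP; have s0 : 0 < s ^+ 2 by rewrite exprn_gt0// (lt_le_trans ltr01).
have r1 (i : 'I_n) := radius_ge1 i s1.
case=> /= [tn|/(notin_xbox)[i xi]]; last first.
  by rewrite /stcutoff (xcutoff_eq0 r1 xi) mulr0.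
rewrite /stcutoff /tcutoff cutoff_eq0 ?mul0r//.
rewrite normrM normfV (gtr0_norm s0) ler_pdivlMr// mul1r leNgt.
apply/negP => /ltW; rewrite ler_norml => ts; apply: tn.
rewrite in_itv /=; move: ts; lra.
Qed.

(** On the box, Young's inequality absorbs the two terms linear in [w] into the first one, at the
    cost of a constant; off the box the cutoff vanishes, and with it all three terms. *)
Lemma weak_integrand_ge (p q w : R) l s t x :
  1 <= s -> 0 < p -> 0 < q -> p^-1 + q^-1 = 1 -> l.+3%:R <= l.+1%:R * p ->
  - ((decay_const l * s ^- 2) `^ q * \1_(stbox s) (t, x)) <=
  `|w| `^ p * test_fun (radius s) (s ^+ 2) l t x
  + w * derive1 (fun t => test_fun (radius s) (s ^+ 2) l t x) t
  + w * sublaplacian X12 (test_fun (radius s) (s ^+ 2) l t) x.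
Proof.
move=> s1 p0 q0 pq lp.
have h1 := test_t_le l t x s1; have h2 := Delta_test_le l t x s1.
set Dt := derive1 _ t in h1 *; set DX := sublaplacian _ _ x in h2 *.
rewrite testE; have P01 := stcutoff_itv s t x.
have C0 : 0 <= decay_const l * s ^- 2.
  by rewrite mulr_ge0 ?decay_const_ge0// invr_ge0 exprn_ge0// (le_trans ler01).
have h3 : `|w * (Dt + DX)| <= `|w| * (decay_const l * s ^- 2 * stcutoff s t x ^+ l.+1).
  rewrite normrM ler_wpM2l//; apply: (le_trans (ler_normD _ _)).
  by apply: (le_trans (lerD h1 h2)); rewrite /decay_const; lra.
have h4 : - (`|w| * (decay_const l * s ^- 2 * stcutoff s t x ^+ l.+1)) <= w * (Dt + DX).
  by move: h3; rewrite ler_norml => /andP[].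
have [B|nB] := pselect (stbox s (t, x)).
  rewrite indicE mem_set// mulr1.
  have := young_cutoff p0 q0 pq lp (normr_ge0 w) C0 P01.
  rewrite mulrDr in h4; lra.
move: h4; rewrite stcutoff_eq0// !expr0n /= !mulr0 oppr0 add0r mulrDr.
by rewrite indicE memNset// mulr0 oppr0.
Qed.

End pointwise.

(** * Fubini's theorem for products of functions of separate variables *)

Section tensor_integral.
Context {d1 d2} {T1 : measurableType d1} {T2 : measurableType d2} {R : realType}.
Variables (m1 : {sigma_finite_measure set T1 -> \bar R})
  (m2 : {sigma_finite_measure set T2 -> \bar R}).

Lemma Rintegral_tensor (g : T1 -> R) (h : T2 -> R) :
  m1.-integrable setT (EFin \o g) -> m2.-integrable setT (EFin \o h) ->
  \int[(m1 \x m2)%E]_z (g z.1 * h z.2) = \int[m1]_x g x * \int[m2]_y h y.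
Proof.
move=> ig ih; have /integrableP[mg _] := ig; have /integrableP[mh ihoo] := ih.
have intgh : (m1 \x m2)%E.-integrable setT (fun z => (g z.1 * h z.2)%:E).
  apply/integrable12ltyP.
    apply/measurable_EFinP; apply: measurable_funM.
      by apply: measurableT_comp => //; apply/measurable_EFinP.
    by apply: measurableT_comp => //; apply/measurable_EFinP.
  (* The iterated integral of the absolute value factors into two finite integrals, which gives
     integrability on the product. *)
  have -> : (\int[m1]_x \int[m2]_y `|(g x * h y)%:E| =
      \int[m1]_x (`|(g x)%:E| * \int[m2]_y `|(h y)%:E|))%E.
    apply: eq_integral => x _; under eq_integral do rewrite EFinM abseM.
    by rewrite ge0_integralZl//; exact: measurableT_comp.
  have /integrableP[_] := integrableZr measurableT (fine (\int[m2]_y `|(h y)%:E|)) ig.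
  rewrite fineK; last by rewrite ge0_fin_numE//; exact: integral_ge0.
  apply: le_lt_trans; rewrite le_eqVlt; apply/orP; left; apply/eqP.
  by apply: eq_integral => x _; rewrite abseM (gee0_abs (integral_ge0 _ _)).
rewrite /Rintegral -integral12_prod_meas1// /fubini_F /=.
have fh : (\int[m2]_y (h y)%:E)%E \is a fin_num by exact: integrable_fin_num.
have fg : (\int[m1]_y (g y)%:E)%E \is a fin_num by exact: integrable_fin_num.
under eq_integral do under eq_integral do rewrite EFinM.
under eq_integral do rewrite integralZl//.
by rewrite -(fineK fh) integralZr// fineM.
Qed.

End tensor_integral.

(** * Measurability, volumes of boxes and the integral of the time bump *)

Section rV_measure.
Context {R : realType} {n : nat}.

Lemma continuous_measurable_rV (g : 'rV[R]_n -> R) :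
  continuous g -> measurable_fun setT g.
Proof.
move=> /continuousP cg; apply: (measurability _ (RGenOpens.measurableE R)).
move=> _ [_ [a [b ->] <-]]; rewrite setTI; apply: open_measurable_rV.
exact/cg/interval_open.
Qed.

Lemma measurable_xbox (r : 'I_n -> R) : measurable (xbox r).
Proof.
rewrite (_ : xbox r = \bigcap_(i in [set: 'I_n])
    ((fun x : 'rV[R]_n => x ord0 i) @^-1` `[- r i, r i])).
  apply: fin_bigcap_measurable => // i _; rewrite -[X in measurable X]setTI.
  exact: measurable_rV_coord.
by apply/seteqP; split=> x /= Ax i; [move=> _|]; exact: Ax.
Qed.

Lemma lebesgue_xbox (r : 'I_n -> R) : (forall i, 0 <= r i) ->
  lebesgue_rV n (xbox r) = (\prod_(i < n) (2 * r i))%:E.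
Proof.
move=> r0; have := @lebesgue_rV_box R n (fun i => `[- r i, r i]%classic).
move=> /(_ (fun i => measurable_itv _)) ->.
rewrite -prodEFin; apply: eq_bigr => i _.
rewrite lebesgue_measure_itv/= lte_fin; case: ltP => h.
  by rewrite -EFinD; congr _%:E; lra.
by congr _%:E; have := r0 i; lra.
Qed.

Lemma measurable_stbox (s : R) : measurable (@stbox R n s).
Proof. by apply: measurableX; [exact: measurable_itv|exact: measurable_xbox]. Qed.

Lemma spacetime_stbox (s : R) : 1 <= s -> spacetime_measure (@stbox R n s) =
  (2 * s ^+ 2 * \prod_(i < n) (2 * radius s i))%:E.
Proof.
move=> s1; have s0 : 0 < s by rewrite (lt_le_trans ltr01).
rewrite /spacetime_measure /stbox /= product_measure1E//; last exact: measurable_xbox.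
rewrite EFinM; congr (_ * _)%E.
  rewrite [LHS]lebesgue_measure_itv/= lte_fin mulr_gt0 ?exprn_gt0//.
  by rewrite oppr0 adde0.
by rewrite -lebesgue_xbox// => i; rewrite exprn_ge0// ltW.
Qed.

Lemma integrable_bump (s : R) l : 0 < s ->
  lebesgue_measure.-integrable setT (EFin \o bump s s l 0).
Proof.
move=> s0; apply: (le_integrable measurableT _ _
  (integrable_indic_itv 0 (2 * s) true false)).
  apply/measurable_EFinP; apply: continuous_measurable_fun.
  exact: continuous_bump.
move=> t _ /=; rewrite lee_fin ger0_norm ?bump0_ge0// bump0E.
rewrite indicE; case: (boolP (_ \in _)) => [_|].
  by rewrite normr1 exprn_ile1 ?cutoff_ge0 ?cutoff_le1.
move=> /negP; rewrite inE/= in_itv/= => /negP tn.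
rewrite cutoff_eq0 ?expr0n ?normr0//.
rewrite normrM normfV (gtr0_norm s0) ler_pdivlMr// mul1r leNgt.
apply: contra tn => /ltW; rewrite ler_norml; lra.
Qed.

(** On [[s/2, 3s/2]], of length [s], one has [|(t - s)/s| <= 1/2], hence the cutoff is at least
    [3/4]. *)
Lemma Rintegral_bump_ge (s : R) l : 0 < s ->
  (3 / 4) ^+ l.+3 * s <= \int[lebesgue_measure]_t bump s s l 0 t.
Proof.
move=> s0; pose I : set (measurableTypeR R) := `[s / 2, 3 * s / 2]%classic.
have -> : (3 / 4) ^+ l.+3 * s = \int[lebesgue_measure]_t ((3 / 4) ^+ l.+3 * \1_I t).
  rewrite RintegralZl//; last exact: integrable_indic_itv.
  congr (_ * _); rewrite /Rintegral integral_indic//; last exact: measurable_itv.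
  have mI : lebesgue_measure I = s%:E.
    rewrite lebesgue_measure_itv/= lte_fin ifT; last lra.
    by rewrite -EFinD; congr _%:E; lra.
  rewrite setIT; exact: (congr1 fine (esym mI)).
apply: le_Rintegral => //.
- have := integrableZl measurableT ((3 / 4) ^+ l.+3)
    (integrable_indic_itv (s / 2) (3 * s / 2) true false).
  exact.
- exact: integrable_bump.
move=> t _; rewrite indicE; case: (boolP (_ \in _)) => [|_]; last first.
  by rewrite mulr0 bump0_ge0.
rewrite inE /I /= in_itv/= mulr1 bump0E => tI.
apply: lerXn2r; rewrite ?nnegrE ?cutoff_ge0 ?divr_ge0//.
rewrite /cutoff /pospow expr1 le_max; apply/orP; right.
suff : ((t - s) / s) ^+ 2 <= 1 / 4 by lra.
have -> : ((t - s) / s) ^+ 2 = (t - s) ^+ 2 / s ^+ 2 by rewrite exprMn exprVn.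
rewrite ler_pdivrMr ?exprn_gt0//; nra.
Qed.

End rV_measure.

(** * Recovering the integral of [f] from truncations to growing boxes *)

Section exhaustion.
Context {R : realType} {n : nat}.
Implicit Types (x : 'rV[R]_n) (s : R).

Let phi l s : 'rV[R]_n -> R := tbump (radius s) l (fun=> 0%N).

Lemma tbump0_itv l s x : 0 <= phi l s x <= 1.
Proof.
by rewrite /phi tbump0E exprn_ge0 ?xcutoff_ge0// exprn_ile1 ?xcutoff_ge0 ?xcutoff_le1.
Qed.

Lemma measurable_tbump l s : measurable_fun setT (phi l s).
Proof. by apply: continuous_measurable_rV; exact: continuous_tbump. Qed.

Lemma cutoff_div_le (y a b : R) : 0 < a -> a <= b -> cutoff (y / a) <= cutoff (y / b).
Proof.
move=> a0 ab; have b0 := lt_le_trans a0 ab.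
rewrite /cutoff /pospow !expr1;
have h : (y / b) ^+ 2 <= (y / a) ^+ 2.
  rewrite !exprMn ler_wpM2l ?sqr_ge0// !exprVn lef_pV2 ?posrE ?exprn_gt0//.
  by rewrite ler_pXn2r// nnegrE ltW.
rewrite ge_max le_max lexx/= le_max; apply/orP; right; lra.
Qed.

(** Each factor increases with its radius; this is the monotonicity required by monotone
    convergence. *)
Lemma tbump_nondecreasing l s s' x : 1 <= s -> s <= s' -> phi l s x <= phi l s' x.
Proof.
move=> s1 ss'; have s0 : 0 < s by rewrite (lt_le_trans ltr01).
rewrite /phi !tbump0E lerXn2r ?nnegrE ?xcutoff_ge0//.
apply: ler_prod => i _; rewrite cutoff_ge0/=; apply: cutoff_div_le.
  by rewrite /radius exprn_gt0.
by rewrite /radius lerXn2r// nnegrE ltW// (lt_le_trans s0).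
Qed.

(** Squeezed between [1 - y^2 / (k + 1)] and 1, since the squared radius is at least [k + 1]. *)
Lemma cvg_cutoff_radius (y : R) (i : 'I_n) :
  cutoff (y / radius k.+1%:R i) @[k --> \oo] --> (1 : R).
Proof.
apply: (@squeeze_cvgr _ _ _ _ (fun k => 1 - y ^+ 2 * harmonic k) (fun=> 1)).
- near=> k; rewrite cutoff_le1 andbT /cutoff /pospow expr1 le_max.
  apply/orP; right; rewrite lerD2l lerN2 exprMn ler_wpM2l ?sqr_ge0//.
  have k1 : 1 <= (k.+1%:R : R) by rewrite ler1n.
  have r1 := radius_ge1 i k1.
  rewrite exprVn lef_pV2 ?posrE ?exprn_gt0 ?(lt_le_trans ltr01)//.
  rewrite /radius -exprM -[leLHS]expr1; apply: ler_weXn2l => //; lia.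
- rewrite -[X in _ --> X]subr0 -(mulr0 (y ^+ 2)).
  apply: cvgB; first exact: cvg_cst.
  by apply: cvgM; [exact: cvg_cst|exact: cvg_harmonic].
- exact: cvg_cst.
Unshelve. all: by end_near. Qed.

Lemma cvg_tbump l x : phi l k.+1%:R x @[k --> \oo] --> (1 : R).
Proof.
have H : xcutoff (radius (k.+1%:R : R)) x @[k --> \oo] --> (1 : R).
  rewrite /xcutoff; elim: (index_enum _) => [|i t ih].
    by under eq_fun do rewrite big_nil; exact: cvg_cst.
  under eq_fun do rewrite big_cons.
  have := cvgM (cvg_cutoff_radius (x ord0 i) i) ih.
  by rewrite mulr1 => H; exact: H.
have := cvg_comp _ (fun y : R => y ^+ l.+3) H (@exprn_continuous _ l.+3 1).
rewrite expr1n => {}H; under eq_fun do rewrite /phi tbump0E.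
exact: H.
Qed.

Lemma integrable_L1loc_tbump (f : 'rV[R]_n -> R) l s : 1 <= s -> L1loc f ->
  (lebesgue_rV n).-integrable setT (fun x => (f x * phi l s x)%:E).
Proof.
move=> s1 [mf fK]; have r1 (i : 'I_n) := radius_ge1 i s1.
have foo := fK _ (@compact_xbox R n (radius s)).
apply/integrableP; split.
  by apply/measurable_EFinP; apply: measurable_funM => //; exact: measurable_tbump.
apply: le_lt_trans foo; rewrite [leRHS]integral_mkcond.
apply: ge0_le_integral => //.
- apply: measurableT_comp => //; apply/measurable_EFinP.
  by apply: measurable_funM => //; exact: measurable_tbump.
- apply/(measurable_restrictT _ (measurable_xbox _)).
  by apply: measurableT_comp => //; apply/measurable_EFinP; exact: measurable_funTS.
move=> x _; have /andP[p0 p1] := tbump0_itv l s x; rewrite patchE.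
case: ifPn => [_|]; first by rewrite lee_fin normrM ler_piMr// ger0_norm.
rewrite notin_setE => /(notin_xbox)[i xi].
by rewrite /phi (tbump_eq0 l r1 _ xi) mulr0 abse0.
Qed.

Lemma cvg_integral_tbump (g : 'rV[R]_n -> R) l :
  measurable_fun setT g -> (forall x, 0 <= g x) ->
  (\int[lebesgue_rV n]_x (g x * phi l k.+1%:R x)%:E @[k --> \oo] -->
   \int[lebesgue_rV n]_x (g x)%:E)%E.
Proof.
move=> mg g0.
have -> : (\int[lebesgue_rV n]_x (g x)%:E = \int[lebesgue_rV n]_x
    limn (fun k => (g x * phi l k.+1%:R x)%:E))%E.
  apply: eq_integral => x _; apply/esym/cvg_lim => //.
  apply/cvg_EFin; first exact: nearW.
  by rewrite -[X in _ --> X]mulr1; apply: cvgM; [exact: cvg_cst|exact: cvg_tbump].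
apply: cvg_monotone_convergence => //.
- move=> k; apply/measurable_EFinP; apply: measurable_funM => //; exact: measurable_tbump.
- by move=> k x _; rewrite lee_fin mulr_ge0//; have /andP[] := tbump0_itv l k.+1%:R x.
- move=> x _ a b ab; rewrite lee_fin ler_wpM2l// tbump_nondecreasing//.
    by rewrite ler1n.
  by rewrite ler_nat ltnS.
Qed.

(** The integral of [f] may be [+oo], so the parts of [f] are treated separately: the truncated
    integrals of [fp] increase to [Ip], while those of [fm] never exceed [Im], which is finite. *)
Lemma Rintegral_tbump_ge (f : 'rV[R]_n -> R) l : L1loc f ->
  (0 < \int[lebesgue_rV n]_x (f x)%:E)%E ->
  exists2 delta : R, 0 < delta &
    \forall k \near \oo, delta <= \int[lebesgue_rV n]_x (f x * phi l k.+1%:R x).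
Proof.
move=> Lf; have [mf _] := Lf.
pose fp x := Num.max (f x) 0; pose fm x := Num.max (- f x) 0.
have fE x : f x = fp x - fm x.
  by rewrite /fp /fm; case: (leP (f x) 0) => h; case: (leP (- f x) 0) => h'; lra.
have fp0 x : 0 <= fp x by rewrite le_max lexx orbT.
have fm0 x : 0 <= fm x by rewrite le_max lexx orbT.
have mfp : measurable_fun setT fp by exact: measurable_maxr.
have mfm : measurable_fun setT fm.
  by apply: measurable_maxr => //; exact: measurableT_comp.
have i1 k : 1 <= (k.+1%:R : R) by rewrite ler1n.
have ip k : (lebesgue_rV n).-integrable setT (fun x => (fp x * phi l k.+1%:R x)%:E).
  apply: le_integrable (integrable_L1loc_tbump l (i1 k) Lf) => //.
    apply/measurable_EFinP; apply: measurable_funM => //; exact: measurable_tbump.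
  move=> x _; rewrite !abse_EFin lee_fin !normrM ler_wpM2r// (ger0_norm (fp0 x)).
  by rewrite /fp ge_max ler_norm normr_ge0.
have im k : (lebesgue_rV n).-integrable setT (fun x => (fm x * phi l k.+1%:R x)%:E).
  apply: le_integrable (integrable_L1loc_tbump l (i1 k) Lf) => //.
    apply/measurable_EFinP; apply: measurable_funM => //; exact: measurable_tbump.
  move=> x _; rewrite !abse_EFin lee_fin !normrM ler_wpM2r// (ger0_norm (fm0 x)).
  by rewrite /fm ge_max -normrN ler_norm normr_ge0.
rewrite integralE.
have -> : (\int[lebesgue_rV n]_x (fun x => (f x)%:E)^\+ x =
    \int[lebesgue_rV n]_x (fp x)%:E)%E.
  by apply: eq_integral => x _; rewrite funeposE -EFin_max.
have -> : (\int[lebesgue_rV n]_x (fun x => (f x)%:E)^\- x =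
    \int[lebesgue_rV n]_x (fm x)%:E)%E.
  by apply: eq_integral => x _; rewrite funenegE -EFinN -EFin_max.
set Ip := (\int[_]_x (fp x)%:E)%E; set Im := (\int[_]_x (fm x)%:E)%E => h.
have Im0 : (0 <= Im)%E by apply: integral_ge0 => x _; rewrite lee_fin.
(* [Im = +oo] would make [Ip - Im] equal to [-oo], even for [Ip = +oo], by the convention on
   extended reals. *)
have Imfin : Im \is a fin_num.
  by rewrite ge0_fin_numE// ltey; apply: contraTneq h => ->; rewrite addeNy.
have ImIp : (Im < Ip)%E by rewrite -sube_gt0.
(* The midpoint if [Ip] is finite, [fine Im + 1] otherwise. *)
have [c Imc cIp] : exists2 c : R, fine Im < c & (c%:E < Ip)%E.
  move: ImIp; rewrite -(fineK Imfin); case: Ip {h} => [r| |] //=.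
    rewrite lte_fin => Imr; exists ((fine Im + r) / 2); rewrite ?lte_fin; lra.
  by move=> _; exists (fine Im + 1); rewrite ?ltry// ltrDl.
exists (c - fine Im); first by rewrite subr_gt0.
have H : \forall k \near \oo,
    (c%:E < \int[lebesgue_rV n]_x (fp x * phi l k.+1%:R x)%:E)%E.
  exact: (cvg_integral_tbump l mfp fp0 (open_ereal_gt' cIp)).
apply: filterS H => k ck.
have -> : \int[lebesgue_rV n]_x (f x * phi l k.+1%:R x) =
    \int[lebesgue_rV n]_x (fp x * phi l k.+1%:R x)
    - \int[lebesgue_rV n]_x (fm x * phi l k.+1%:R x).
  rewrite -(RintegralB measurableT (ip k) (im k)); congr Rintegral.
  by apply/funext => x; rewrite fE mulrBl.
apply: lerB.
  by rewrite -lee_fin fineK ?ltW//; exact: integrable_fin_num.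
apply: fine_le => //; first exact: integrable_fin_num.
apply: ge0_le_integral => //.
- by move=> x _; rewrite lee_fin mulr_ge0//; have /andP[] := tbump0_itv l k.+1%:R x.
- by have /integrableP[] := im k.
- exact/measurable_EFinP.
move=> x _; rewrite lee_fin ler_piMr//.
by have /andP[] := tbump0_itv l k.+1%:R x.
Qed.

End exhaustion.

(** * The weak identity tested on the dilated bumps *)

Section test_identity.
Context {R : realType} {n : nat}.

(** The time factor vanishes for [t <= 0], so the domain extends to the whole line, where the
    integrand is a tensor product. *)
Lemma Rintegral_f_test (f : 'rV[R]_n -> R) (s : R) l : 1 <= s -> L1loc f ->
  \int[spacetime_measure]_(z in time_oo +oo%E `*` setT)
     (f z.2 * test_fun (radius s) (s ^+ 2) l z.1 z.2) =
  \int[lebesgue_measure]_t bump (s ^+ 2) (s ^+ 2) l 0 t *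
  \int[lebesgue_rV n]_x (f x * tbump (radius s) l (fun=> 0%N) x).
Proof.
move=> s1 Lf; have s0 : 0 < s ^+ 2 by rewrite exprn_gt0// (lt_le_trans ltr01).
rewrite -Rintegral_tensor; last 2 first.
- exact: integrable_bump.
- exact: integrable_L1loc_tbump.
rewrite Rintegral_mkcond; congr Rintegral; apply/funext => -[t x].
rewrite patchE /test_fun /= mulrCA; case: ifPn => //; rewrite notin_setE => tQ.
rewrite bump_eq0 ?mul0r// ler_normr; apply/orP; right.
rewrite opprB lerBrDl gerDr leNgt; apply/negP => t0.
by apply: tQ; split => //; split => //; exact: ltry.
Qed.

(** The pointwise bound [weak_integrand_ge] is integrated; the right side is the constant from
    Young's inequality times the volume of [stbox s]. *)
Lemma test_estimate (p q : R) (f u0 : 'rV[R]_n -> R) (u : R -> 'rV[R]_n -> R)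
    (s : R) l :
  1 <= s -> 0 < p -> 0 < q -> p^-1 + q^-1 = 1 -> l.+3%:R <= l.+1%:R * p ->
  L1loc f -> global_weak_solution p X12 f u0 u ->
  \int[lebesgue_measure]_t bump (s ^+ 2) (s ^+ 2) l 0 t *
  \int[lebesgue_rV n]_x (f x * tbump (radius s) l (fun=> 0%N) x) <=
  (@decay_const R n l * s ^- 2) `^ q *
    (2 * s ^+ 2 * \prod_(i < n) (2 * radius s i)).
Proof.
move=> s1 p0 q0 pq lp Lf [_ wu].
have s0 : 0 < s ^+ 2 by rewrite exprn_gt0// (lt_le_trans ltr01).
have r1 (i : 'I_n) := radius_ge1 i s1.
have psi0 t (x : 'rV[R]_n) : time_co +oo%E t -> 0 <= test_fun (radius s) (s ^+ 2) l t x.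
  by move=> _; rewrite testE exprn_ge0//; have /andP[] := stcutoff_itv s t x.
have [i1 i2 i3] := wu _ (C1c_C2c_test l r1 s0) psi0.
rewrite Rintegral_f_test//.
have -> : \int[lebesgue_rV n]_x (u0 x * test_fun (radius s) (s ^+ 2) l 0 x) = 0.
  rewrite (_ : (fun x => _) = cst 0); last first.
    apply/funext => x; rewrite /test_fun bump_eq0 ?mul0r ?mulr0//.
    by rewrite sub0r normrN ler_norm.
  by rewrite Rintegral_cst// mul0r.
set Q := (X in Rintegral _ X _).
have mQ : measurable (Q : set (measurableTypeR R * 'rV[R]_n)).
  apply: measurableX => //.
  rewrite (_ : time_oo +oo%E = `]0, +oo[%classic); first exact: measurable_itv.
  apply/seteqP; split => t /=; rewrite in_itv/= andbT; first by case.
  by move=> t0; split => //; exact: ltry.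
set K := (_ `^ q); set V := 2 * s ^+ 2 * _.
have K0 : 0 <= K by exact: powR_ge0.
have mB := @measurable_stbox R n s.
have muB := @spacetime_stbox R n s s1.
have muBQ : (spacetime_measure (@stbox R n s `&` Q) <= V%:E)%E.
  by rewrite -muB; apply: le_measure; rewrite ?inE//; exact: measurableI.
have iB : spacetime_measure.-integrable Q (EFin \o \1_(@stbox R n s)).
  apply/integrableP; split; first by apply/measurable_EFinP.
  under eq_integral do rewrite /= ger0_norm//.
  rewrite integral_indic//; exact: le_lt_trans muBQ (ltry _).
have iKB := integrableZl mQ (- K) iB.
have lb : - (K * V) <= \int[spacetime_measure]_(z in Q) (- K * \1_(@stbox R n s) z).
  rewrite RintegralZl// mulNr lerN2 ler_wpM2l//.
  rewrite /Rintegral integral_indic// -[leRHS]/(fine V%:E).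
  apply: fine_le => //.
  rewrite ge0_fin_numE; first exact: le_lt_trans muBQ (ltry _).
  exact: measure_ge0.
set I := _ * \int[_]_x _.
move=> eqn; have i12 := integrableD mQ i1 i2.
(* By the identity the term in [f] is minus the sum of the three terms in [u], so an upper bound for
   it is a lower bound for their sum. *)
suff H : - (K * V) <= \int[spacetime_measure]_(z in Q)
  (`|u z.1 z.2| `^ p * test_fun (radius s) (s ^+ 2) l z.1 z.2
   + u z.1 z.2 * derive1 (fun t => test_fun (radius s) (s ^+ 2) l t z.2) z.1
   + u z.1 z.2 * sublaplacian X12 (test_fun (radius s) (s ^+ 2) l z.1) z.2).
  rewrite (RintegralD mQ i12 i3) (RintegralD mQ i1 i2) in H.
  move: eqn H; set A1 := Rintegral _ _ _; set A2 := Rintegral _ _ _.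
  set A3 := Rintegral _ _ _ => eqn H; lra.
apply: (le_trans lb).
apply: (le_Rintegral mQ iKB (integrableD mQ i12 i3)) => -[t x] _.
rewrite mulNr; exact: weak_integrand_ge.
Qed.

End test_identity.

(** * The homogeneous dimension and the limit of large scales *)

Lemma sum_weights n : (2 * \sum_(i < n) i.+1 = n ^ 2 + n)%N.
Proof.
elim: n => [|n ih]; first by rewrite big_ord0.
by rewrite big_ord_recr /= mulnDr ih; lia.
Qed.

(** The exponent is the homogeneous dimension, the sum of the weights [i + 1]; as a real power it
    combines with exponents involving [q]. *)
Lemma volume_powR (R : realType) (n : nat) (s : R) : 0 <= s ->
  \prod_(i < n) (2 * radius s i) = 2 ^+ n * s `^ ((n%:R ^+ 2 + n%:R) / 2).
Proof.
move=> s0; rewrite big_split/= prodr_const card_ord /radius -expr_sum.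
rewrite -(powR_mulrn (\sum_(i < n) i.+1) s0); congr (_ * _ `^ _).
have := congr1 (fun m => m%:R : R) (sum_weights n).
rewrite natrM natrD natrX; lra.
Qed.

Theorem theorem4p5 (R : realType) (n : nat) (p : R)
    (u0 f : 'rV[R]_n -> R)
    (n_gt2 : (2 < n)%N)
    (p_gt1 : 1 < p)
    (p_lt : p < (n%:R ^+ 2 + n%:R) / (n%:R ^+ 2 + n%:R - 4))
    (u0_loc : L1loc u0)
    (f_loc : L1loc f)
    (f_pos : (0 < \int[lebesgue_rV n]_x (f x)%:E)%E) :
  ~ exists u : R -> 'rV[R]_n -> R, global_weak_solution p X12 f u0 u.
Proof.
move=> [u wu].
(* [q] is the exponent conjugate to [p], and [T] is the homogeneous dimension. *)
pose q := p / (p - 1); pose T : R := (n%:R ^+ 2 + n%:R) / 2.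
have p0 : 0 < p by lra.
have p10 : 0 < p - 1 by lra.
have q0 : 0 < q by rewrite divr_gt0.
have pq : p^-1 + q^-1 = 1 by rewrite /q; field; rewrite !gt_eqF.
(* Clearing positive denominators turns this into the bound on [p], which reads
   [p < T / (T - 2)]. *)
have a0 : 0 < 2 * q - T.
  have n3 : 3 <= n%:R :> R by rewrite ler_nat.
  have D0 : 0 < n%:R ^+ 2 + n%:R - 4 :> R by nra.
  move: p_lt; rewrite ltr_pdivlMr// => h.
  have -> : 2 * q - T = (4 * p - (n%:R ^+ 2 + n%:R) * (p - 1)) / (2 * (p - 1)).
    by rewrite /q /T; field; rewrite gt_eqF.
  by rewrite divr_gt0 ?mulr_gt0//; lra.
(* The truncation gives [2 < (l + 1) (p - 1)], that is, [l + 3 < (l + 1) p]. *)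
pose l := Num.truncn (2 / (p - 1)).
have lp : l.+3%:R <= l.+1%:R * p.
  have := truncnS_gt (2 / (p - 1)); rewrite -/l ltr_pdivrMr// => h.
  by rewrite -[l.+3%:R]/((2 + l.+1)%:R) natrD; lra.
have [delta delta0 [N _ fN]] := Rintegral_tbump_ge l f_loc f_pos.
pose c : R := (3 / 4) ^+ l.+3; pose C : R := @decay_const R n l.
have c0 : 0 < c by rewrite exprn_gt0//; lra.
(* What is left of the estimate after all powers of the scale are moved to the left side. *)
pose M := C `^ q * (2 * 2 ^+ n) / (c * delta).
have M0 : 0 <= M.
  have := powR_ge0 C q; rewrite /M => CC; apply: divr_ge0.
    by apply: mulr_ge0 => //; apply: mulr_ge0 => //; exact: exprn_ge0.
  by rewrite ltW// mulr_gt0.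
have le_M k : (N <= k)%N -> (k.+1%:R : R) `^ (2 * q - T) <= M.
  move=> Nk; set s : R := k.+1%:R.
  have s1 : 1 <= s by rewrite ler1n.
  have s0 : 0 < s by rewrite (lt_le_trans ltr01).
  have := test_estimate s1 p0 q0 pq lp f_loc wu.
  rewrite (volume_powR n (ltW s0)) -/T -/C => h.
  have h2 : c * s ^+ 2 * delta <= (C * s ^- 2) `^ q * (2 * s ^+ 2 * (2 ^+ n * s `^ T)).
    apply: le_trans h; apply: ler_pM.
    - by rewrite mulr_ge0 ?exprn_ge0// ltW.
    - exact: ltW.
    - by apply: Rintegral_bump_ge; rewrite exprn_gt0.
    - exact: fN.
  have E : (C * s ^- 2) `^ q = C `^ q * s `^ (- (2 * q)).
    rewrite powRM ?decay_const_ge0 ?invr_ge0 ?exprn_ge0 ?(ltW s0)//.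
    by rewrite -(powR_mulrn 2 (ltW s0)) -powRN -powRrM mulNr.
  rewrite E in h2.
  rewrite /M (ler_pdivlMr _ _ (mulr_gt0 c0 delta0)).
  have -> : s `^ (2 * q - T) = s `^ (2 * q) * s `^ (- T).
    by rewrite -powRD// gt_eqF// implybT.
  rewrite powRN; rewrite powRN in h2.
  set X := s `^ (2 * q) in h2 *; set Y := s `^ T in h2 *; set D := C `^ q in h2 *.
  have X0 : 0 < X by exact: powR_gt0.
  have Y0 : 0 < Y by exact: powR_gt0.
  have s20 : 0 < s ^+ 2 by rewrite exprn_gt0.
  (* Both sides of [h2] are multiplied by [X / (s^2 Y)], which isolates [s^(2q - T)]. *)
  have -> : X / Y * (c * delta) = c * s ^+ 2 * delta * (X / (s ^+ 2 * Y)).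
    by field; rewrite !gt_eqF.
  have -> : D * (2 * 2 ^+ n) =
      D / X * (2 * s ^+ 2 * (2 ^+ n * Y)) * (X / (s ^+ 2 * Y)).
    by field; rewrite !gt_eqF.
  by rewrite ler_wpM2r// divr_ge0 ?mulr_ge0// ltW.
(* The scale [j + 1] lies beyond the threshold [N] and exceeds [M^(1/(2q - T))], so its power
   [2q - T] exceeds [M]. *)
pose j := maxn N (Num.truncn (M `^ (2 * q - T)^-1)).
have := le_M j (leq_maxl _ _); apply/negP; rewrite -ltNge.
have {1}-> : M = (M `^ (2 * q - T)^-1) `^ (2 * q - T).
  by rewrite -powRrM mulVf ?powRr1// gt_eqF.
apply: gt0_ltr_powR; rewrite ?nnegrE ?powR_ge0//.
by rewrite (lt_le_trans (truncnS_gt _))// ler_nat ltnS leq_maxr.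
Qed.
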